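(* Let $n\ge 4$ be an integer, let the height $h$ be the naive height, the Mahler measure, or the length, and let $\epsilon\in(0,1)$ be a fixed number. Let $\lambda_0>0$ be the constant (depending only on $n$ and $h$) for which $f_0(\delta)\sim\lambda_0\,\delta^{\frac{n+2}{2n}}$ as $\delta\to0^+$. Then for all $v\in\left[\epsilon,(1-\epsilon)\frac{n}{n+2}\right]$ $$\#\mathcal{P}_n^{(0)}(Q,v)\sim\lambda_0\,Q^{\,n+1-\frac{n+2}{n}v}\quad\text{as }Q\to\infty.$$
   Context: For a real polynomial $P(x)=\sum_{k=0}^n a_kx^k=a_n\prod_{j=1}^n(x-\alpha_j)$ of degree $n$ (with $\alpha_j\in\mathbb{C}$), the discriminant is $D(P)=a_n^{2n-2}\prod_{1\le i<j\le n}(\alpha_i-\alpha_j)^2$. The naive height is $\max_{0\le k\le n}|a_k|$, the Mahler measure is $|a_n|\prod_{j=1}^n\max(1,|\alpha_j|)$, and the length is $\sum_{k=0}^n|a_k|$; each is viewed as a function $h$ of the coefficient vector, extended continuously to all of $\mathbb{R}^{n+1}$. For $Q>1$, $v\ge 0$, $\mathcal{P}_n^{(0)}(Q,v)$ is the set of polynomials $P$ with integer coefficients, of degree exactly $n$, with $h(P)\le Q$, $|D(P)|\le Q^{2n-2-2v}$, and all roots real. For $\delta\ge0$, $f_0(\delta)$ is the $(n+1)$-dimensional Lebesgue measure of the set of $\mathbf{a}=(a_0,\dots,a_n)\in\mathbb{R}^{n+1}$ with $a_n\ne0$ such that all roots of $\sum_{j=0}^na_jx^j$ are real, $h(\mathbf{a})\le1$,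 and the absolute value of the discriminant of $\sum_{j=0}^n a_jx^j$ is at most $\delta$; the existence of $\lambda_0$ is a theorem of the same paper. The notation $F\sim G$ means that the ratio $F/G$ tends to $1$. *)

(* Defs.v *)
From HB Require Import structures.
From mathcomp Require Import all_boot all_order all_algebra.
From mathcomp Require Import complex.
From mathcomp Require Import all_classical all_reals all_analysis.

Set Implicit Arguments.
Unset Strict Implicit.
Unset Printing Implicit Defensive.

Import Order.TTheory GRing.Theory Num.Theory.
Import numFieldNormedType.Exports.

Local Open Scope classical_set_scope.
Local Open Scope ring_scope.

(* Lebesgue measure on R^n, as the n-fold product measure on n.-tuple R with
   its Borel sigma-algebra; lebesgue_tuple_box computes it on boxes. *)
Section LebesgueTuple.
Variable R : realType.
Local Notation T := (measurableTypeR R).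

Section Step.
Variables (n : nat) (mu : {sigma_finite_measure set (n.-tuple T) -> \bar R}).

Definition tuple_cons (x : T * n.-tuple T) : n.+1.-tuple T :=
  [tuple of x.1 :: x.2].

Lemma measurable_tuple_cons : measurable_fun setT tuple_cons.
Proof. by apply: measurable_cons. Qed.

Definition lebesgue_cons : set (n.+1.-tuple T) -> \bar R :=
  pushforward (@lebesgue_measure R \x mu)%E tuple_cons.

Let lebesgue_cons0 : lebesgue_cons set0 = 0%E.
Proof. by rewrite /lebesgue_cons /pushforward preimage_set0 measure0. Qed.

Let lebesgue_cons_ge0 A : (0 <= lebesgue_cons A)%E.
Proof. by rewrite /lebesgue_cons /pushforward measure_ge0. Qed.

Let lebesgue_cons_sigma_additive : semi_sigma_additive lebesgue_cons.
Proof.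
have mcons (B : set (n.+1.-tuple T)) :
    measurable B -> measurable (tuple_cons @^-1` B).
  by move=> mB; rewrite -[X in measurable X]setTI; exact: measurable_tuple_cons.
move=> F mF tF mUF; rewrite /lebesgue_cons /pushforward preimage_bigcup.
apply: measure_semi_sigma_additive => [k||]; first exact: mcons.
- apply/trivIsetP => i j _ _ ij; rewrite -preimage_setI.
  by move/trivIsetP : tF => /(_ _ _ _ _ ij) ->//; rewrite preimage_set0.
- by rewrite -preimage_bigcup; exact: mcons.
Qed.

HB.instance Definition _ := isMeasure.Build _ _ _ lebesgue_cons
  lebesgue_cons0 lebesgue_cons_ge0 lebesgue_cons_sigma_additive.

Let tuple_uncons (t : n.+1.-tuple T) : T * n.-tuple T :=
  (tnth t ord0, [tuple of behead t]).

Let measurable_tuple_uncons : measurable_fun setT tuple_uncons.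
Proof.
apply: measurable_fun_pair; [exact: measurable_tnth|exact: measurable_behead].
Qed.

Let tuple_consK x : tuple_uncons (tuple_cons x) = x.
Proof. by case: x => x t; congr pair; apply: val_inj. Qed.

Let lebesgue_cons_sigma_finite : sigma_finite setT lebesgue_cons.
Proof.
have /sigma_finiteP[F [TF ndF Foo]] := sigma_finiteT (@lebesgue_measure R).
have /sigma_finiteP[G [TG ndG Goo]] := sigma_finiteT mu.
have TFG : \bigcup_k (F k `*` G k) = setT.
  apply/seteqP; split => // -[x t] _.
  have [i _ Fix] : (\bigcup_k F k) x by rewrite -TF.
  have [j _ Gjt] : (\bigcup_k G k) t by rewrite -TG.
  exists (maxn i j) => //; split => /=.
  - by move: x Fix; exact/subsetPset/ndF/leq_maxl.
  - by move: t Gjt; exact/subsetPset/ndG/leq_maxr.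
exists (fun k => tuple_uncons @^-1` (F k `*` G k)).
  by rewrite -preimage_bigcup TFG preimage_setT.
move=> k; have [mF Fk] := Foo k; have [mG Gk] := Goo k; split.
  rewrite -[X in measurable X]setTI; apply: measurable_tuple_uncons => //.
  exact: measurableX.
rewrite /lebesgue_cons /pushforward -comp_preimage.
rewrite (_ : tuple_uncons \o tuple_cons = id); last exact/funext.
rewrite preimage_id.
by rewrite product_measure1E// lte_mul_pinfty// ge0_fin_numE.
Qed.

HB.instance Definition _ :=
  Measure_isSigmaFinite.Build _ _ _ lebesgue_cons lebesgue_cons_sigma_finite.

End Step.

Fixpoint lebesgue_tuple (n : nat) :
    {sigma_finite_measure set (n.-tuple T) -> \bar R} :=
  match n with
  | 0 => \d_([tuple] : 0.-tuple T)
  | m.+1 => lebesgue_cons (lebesgue_tuple m)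
  end.

Let box n (a b : n.-tuple R) : set (n.-tuple T) :=
  [set t | forall i, tnth a i <= tnth t i <= tnth b i].

Let measurable_box n (a b : n.-tuple R) : measurable (box a b).
Proof.
rewrite (_ : box a b = \bigcap_(i in [set: 'I_n])
    ((fun t : n.-tuple T => tnth t i) @^-1` `[tnth a i, tnth b i])).
  apply: fin_bigcap_measurable => // i _.
  by rewrite -[X in measurable X]setTI; exact: measurable_tnth.
apply/seteqP; split=> [t abt i _ /=|t abt i]; first by rewrite in_itv /= abt.
by have := abt i Logic.I; rewrite /= in_itv.
Qed.

Lemma lebesgue_tuple_box n (a b : n.-tuple R) :
    (forall i, tnth a i <= tnth b i) ->
  lebesgue_tuple n [set t | forall i, tnth a i <= tnth t i <= tnth b i] =
  (\prod_(i < n) (tnth b i - tnth a i))%:E.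
Proof.
elim: n a b => [|n IHn] a b ab; first by rewrite big_ord0 /= diracE mem_set// => -[].
have beheadE (c : n.+1.-tuple R) i :
    tnth [tuple of behead c] i = tnth c (lift ord0 i).
  by rewrite [in RHS](tuple_eta c) tnthS.
have mI : lebesgue_measure `[tnth a ord0, tnth b ord0]%classic =
    (tnth b ord0 - tnth a ord0)%:E :> \bar R.
  rewrite lebesgue_measure_itv/= lte_fin; case: ltP => // ba.
  by apply/eqP; rewrite eq_sym eqe subr_eq0; apply/eqP/le_anti; rewrite ba ab.
pose a' := [tuple of behead a]; pose b' := [tuple of behead b].
rewrite /= /lebesgue_cons /pushforward.
rewrite (_ : _ @^-1` _ = `[tnth a ord0, tnth b ord0]%classic `*` box a' b').
  rewrite product_measure1E//; last exact: measurable_box.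
  rewrite IHn; last by move=> i; rewrite !beheadE.
  rewrite big_ord_recl EFinM; congr (_ * _)%E.
    exact: mI.
  by congr EFin; apply: eq_bigr => i _; rewrite !beheadE.
apply/seteqP; split => [[x t] /= H|[x t] /= [H0 H] i].
  split=> [|i]; first by rewrite /= in_itv; exact: H ord0.
  by have := H (lift ord0 i); rewrite tnthS -!beheadE.
have [j ->|->] := unliftP ord0 i; last by move: H0; rewrite /= in_itv.
by rewrite tnthS -!beheadE; exact: H.
Qed.

End LebesgueTuple.

Inductive height_kind := NaiveHeight | MahlerMeasure | Length.

Section Polynomials.
Variable R : realType.
Implicit Types P : {poly R}.

Definition complex_poly P : {poly R[i]} := map_poly (real_complex R) P.

(* The complex roots of P, listed with multiplicity. *)
Definition croots P : seq R[i] :=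
  sval (closed_field_poly_normal (complex_poly P)).

Lemma crootsP P : P != 0 ->
  complex_poly P = (real_complex R (lead_coef P)) *: \prod_(z <- croots P) ('X - z%:P)
  /\ size (croots P) = (size P).-1.
Proof.
move=> P0; have := svalP (closed_field_poly_normal (complex_poly P)).
rewrite -/(croots P) lead_coef_map => E; split=> //.
have := congr1 (size : {poly R[i]} -> nat) E.
rewrite size_map_poly size_scale ?fmorph_eq0 ?lead_coef_eq0//.
by rewrite size_prod_XsubC => ->.
Qed.

Definition real_rooted P : Prop :=
  forall z : R[i], root (complex_poly P) z -> complex.Im z = 0.

Definition discriminant P : R[i] :=
  let n := (size P).-1 in
  let alpha := croots P in
  real_complex R (lead_coef P) ^+ (2 * n - 2) *
  \prod_(i < n) \prod_(j < n | (i < j)%N) (alpha`_i - alpha`_j) ^+ 2.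

Definition abs_discriminant P : R := Normc.normc (discriminant P).

Definition naive_height P : R := \big[Num.max/0]_(k < size P) `|P`_k|.

Definition mahler_measure P : R :=
  `|lead_coef P| * \prod_(z <- croots P) Num.max 1 (Normc.normc z).

Definition poly_length P : R := \sum_(k < size P) `|P`_k|.

(* As functions of a coefficient vector a, evaluated at Poly a, these are
   continuous on all of R^(n+1): for the Mahler measure, whose formula uses the
   actual degree of P, the value at a vector with a_n = 0 is the limit. *)
Definition height (h : height_kind) P : R :=
  match h with
  | NaiveHeight => naive_height P
  | MahlerMeasure => mahler_measure P
  | Length => poly_length P
  end.

Definition int_polys (n : nat) (h : height_kind) (Q v : R) : set {poly int} :=
  [set p | let P : {poly R} := map_poly intr p in
    [/\ size p = n.+1,
        height h P <= Q,
        abs_discriminant P <= Q `^ (2 * n%:R - 2 - 2 * v) &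
        real_rooted P]].

Definition coef_region (n : nat) (h : height_kind) (delta : R) :
    set (n.+1.-tuple (measurableTypeR R)) :=
  [set a : n.+1.-tuple R | let P : {poly R} := Poly a in
    [/\ tnth a ord_max != 0,
        real_rooted P,
        height h P <= 1 &
        abs_discriminant P <= delta]].

(* The region lies in a bounded box, so that its measure is finite. *)
Definition f0 (n : nat) (h : height_kind) (delta : R) : R :=
  fine (lebesgue_tuple R n.+1 (coef_region h delta)).

End Polynomials.

(* Main.v *)
Require Import Defs.
From mathcomp Require Import all_boot all_order all_fingroup all_algebra.
From mathcomp Require Import finmap complex polyrcf ring lra.
From mathcomp Require Import all_classical all_reals all_analysis.
From mathcomp Require Import measurable_realfun.
From mathcomp Require Import -(notations) mpoly.
Set Implicit Arguments.
Unset Strict Implicit.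
Unset Printing Implicit Defensive.
Import Order.TTheory GRing.Theory Num.Theory.
Import numFieldNormedType.Exports.
Local Open Scope classical_set_scope.
Local Open Scope ring_scope.

(* An integer polynomial P with coefficient vector p lies in the counted set iff
   p / Q lies in S(delta), the region defining f0 (delta), with delta = Q^(-2v).
   On vectors with a_n <> 0, S(delta) is cut out by finitely many inequalities
   G(a) <= c, with G a polynomial divided by a power of a_n: reality of the roots
   says that the coefficients of prod_(i,j) (X + (alpha_i - alpha_j)^2) are
   nonnegative, and these, being symmetric in the roots, are rational in a; the
   discriminant and the heights are treated likewise.  Hence every line parallel
   to a coordinate axis meets S(delta) in a number of intervals bounded
   independently of delta.  Replacing sums by integrals one coordinate at a time,
   which needs this only for lines and not for projections, the number of points
   of (1/Q) Z^(n+1) in S(delta) is Q^(n+1) f0(delta) + O(Q^n) uniformly in delta.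
   Since v <= (1 - epsilon) n / (n + 2), the main term has order at least
   Q^(n + epsilon), and v >= epsilon makes delta tend to 0 uniformly in v. *)

(** * Counting in dimension one *)

Section Discrepancy.
Context {R : realType}.
Variables (Q : R) (M : nat).
Hypothesis Q_gt0 : 0 < Q.
Implicit Types (L : set R) (s : seq R).
Local Notation mu := (@lebesgue_measure R).

(** For [i < M.*2.+1] these are the points of (1/Q) Z in [-M/Q, M/Q]; the shift by [M] lets ordinals
    index them. *)
Definition grid (i : nat) : R := (i%:R - M%:R) / Q.

Definition grid_count L : R := \sum_(i < M.*2.+1) \1_L (grid i).

Definition discrepancy_le (k : R) L := measurable L /\
  exists2 l : R, mu L = l%:E & `|grid_count L - Q * l| <= k.

Lemma discrepancy_le0 : discrepancy_le 0 set0.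
Proof.
split=> //; exists 0; first by rewrite measure0.
rewrite /grid_count mulr0 subr0 big1 ?normr0// => i _.
by rewrite indicE in_set0.
Qed.

Lemma discrepancy_leU k1 k2 L1 L2 : L1 `&` L2 = set0 ->
  discrepancy_le k1 L1 -> discrepancy_le k2 L2 -> discrepancy_le (k1 + k2) (L1 `|` L2).
Proof.
move=> L0 [mL1 [l1 L1E d1]] [mL2 [l2 L2E d2]].
split; first exact: measurableU.
exists (l1 + l2).
  have -> : mu (L1 `|` L2) = (mu L1 + mu L2)%E by exact: measureU.
  by rewrite L1E L2E.
have -> : grid_count (L1 `|` L2) = grid_count L1 + grid_count L2.
  rewrite /grid_count -big_split/=; apply: eq_bigr => i _.
  rewrite !indicE in_setU -natrD; congr (_%:R).
  have [x1|_] := boolP (_ \in L1); have [x2|_] := boolP (_ \in L2) => //=.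
  exfalso; have : (L1 `&` L2) (grid i) by split; exact: set_mem.
  by rewrite L0.
rewrite mulrDr opprD addrACA (le_trans (ler_normD _ _))//.
exact: lerD.
Qed.

Lemma discrepancy_leW k1 k2 L : k1 <= k2 -> discrepancy_le k1 L -> discrepancy_le k2 L.
Proof.
move=> k12 [mL [l LE d]]; split=> //; exists l => //.
exact: le_trans d k12.
Qed.

Lemma grid_inj : injective grid.
Proof.
move=> i j /(mulIf (invr_neq0 (lt0r_neq0 Q_gt0)))/addIr/eqP.
by rewrite eqr_nat => /eqP.
Qed.

Lemma discrepancy_le1 x : discrepancy_le 1 [set x].
Proof.
split=> //; exists 0; first by rewrite lebesgue_measure_set1.
rewrite mulr0 subr0 ger0_norm; last by apply: sumr_ge0 => i _; rewrite indicE.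
rewrite /grid_count; under eq_bigr do rewrite indicE.
rewrite -natr_sum -[leRHS]/(1%:R) ler_nat.
under eq_bigr do rewrite -[nat_of_bool _]/((if (grid _ \in [set x]) then 1 else 0)%N).
rewrite -big_mkcond/= sum1_card; apply/card_le1_eqP => i j.
rewrite !unfold_in/= => /set_mem xi /set_mem xj; apply: val_inj; apply: grid_inj.
by rewrite xi.
Qed.

Lemma sum_ord_lt N t : (t <= N)%N -> \sum_(i < N) (i < t)%N%:R = t%:R :> R.
Proof.
move=> tN; rewrite -natr_sum; congr (_%:R).
under eq_bigr => i _ do rewrite -[nat_of_bool _]/((if (i < t)%N then 1 else 0)%N).
by rewrite -big_mkcond/= -(@big_ord_widen _ _ _ t N (fun=> 1%N)) ?sum1_card ?card_ord.
Qed.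

Lemma lt_grid i x : (grid i < x) = (i%:R < Q * x + M%:R).
Proof. by rewrite /grid ltr_pdivrMr// ltrBlDr mulrC. Qed.

Lemma gt_grid i x : (x < grid i) = (Q * x + M%:R < i%:R).
Proof. by rewrite /grid ltr_pdivlMr// ltrBrDr mulrC. Qed.

(** Under x -> Q x + M the grid becomes the integers 0, ..., 2M, and an open interval inside their
    range holds a number of integers within 1 of its length. *)
Lemma discrepancy_le_itv u v : u <= v -> - M%:R <= Q * u -> Q * v <= M%:R ->
  discrepancy_le 1 `]u, v[%classic.
Proof.
move=> uv Mu vM; split=> //; exists (v - u).
  rewrite lebesgue_measure_itv/= lte_fin; case: ltP => // vu.
  by apply/eqP; rewrite eq_sym eqe subr_eq0; apply/eqP/le_anti; rewrite uv vu.
have Quv : Q * u <= Q * v by rewrite ler_pM2l.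
pose y := Q * u + M%:R; pose z := Q * v + M%:R.
have y0 : 0 <= y by rewrite -lerBlDr sub0r.
have yz : y <= z by rewrite lerD2r.
have [a [a1 a2]] : exists a : nat, a%:R <= y /\ y < a.+1%:R.
  by exists (Num.truncn y); have /andP[] := truncn_itv y0.
have [b [b1 b2]] : exists b : nat, z <= b%:R /\ b%:R < z + 1.
  have c0 : 0 <= Num.ceil z by rewrite ceil_ge0;
    apply: lt_le_trans (le_trans y0 yz); rewrite ltrN10.
  exists `|Num.ceil z|%N; rewrite natr_absz ger0_norm// ceil_ge; split=> //.
  by rewrite -ltrBlDr; have := ceilB1_lt z; rewrite intrB.
have zM : z <= M.*2%:R by rewrite -addnn natrD lerD2r.
have bM : (b <= M.*2.+1)%N.
  by rewrite -ltnS -(ltr_nat R) (lt_le_trans b2)//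
    -[M.*2.+2]addn1 natrD lerD2r -[M.*2.+1]addn1 natrD; lra.
have aM : (a.+1 <= M.*2.+1)%N.
  by rewrite ltnS -(ler_nat R) (le_trans a1)// (le_trans yz).
(* Indices below [z] minus indices at most [y]; the minimum covers the case where y = z is an
   integer and [b] lies below [a.+1]. *)
have countE : grid_count `]u, v[%classic =
    \sum_(i < M.*2.+1) ((i < b)%N%:R - (i < minn a.+1 b)%N%:R).
  apply: eq_bigr => i _; rewrite indicE.
  have -> : (grid i \in `]u, v[%classic) = (i < b)%N && ~~ (i < a.+1)%N.
    have -> : (grid i \in `]u, v[%classic) = (u < grid i < v).
      by apply/idP/idP => [/set_mem|H]; [|apply/mem_set]; rewrite /= in_itv.
    rewrite lt_grid gt_grid -/y -/z andbC -leqNgt; congr (_ && _).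
      apply/idP/idP => [iz|ib]; first by rewrite -(ltr_nat R) (lt_le_trans iz).
      have : i.+1%:R < z + 1 by rewrite (le_lt_trans _ b2)// ler_nat.
      by rewrite -natr1 ltrD2r.
    apply/idP/idP => [yi|ai]; last by rewrite (lt_le_trans a2)// ler_nat.
    by rewrite -(ltr_nat R) (le_lt_trans a1).
  rewrite leq_min; case: (i < b)%N; case: (i < a.+1)%N => //=; lra.
rewrite countE sumrB !sum_ord_lt//; last by rewrite geq_min aM.
have -> : Q * (v - u) = z - y by rewrite /z /y; ring.
have [ab|ba] := leqP a.+1 b.
  by rewrite ler_distl -natr1; move: a1 a2; rewrite -natr1 => *; lra.
have : b%:R <= a%:R :> R by rewrite ler_nat -ltnS.
by rewrite ler_distl => ?; move: a1 a2; rewrite -natr1 => *; lra.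
Qed.

(** Equivalently, within []u, v[] the set [L] is a union of points of [s] and of components of the
    complement of [s]. *)
Definition const_off L s (u v : R) := forall x y, u < x -> x <= y -> y < v ->
  (forall r, r \in s -> ~~ (x <= r <= y)) -> L x <-> L y.

Lemma discrepancy_le_const0 L u v : u <= v -> - M%:R <= Q * u -> Q * v <= M%:R ->
  const_off L [::] u v -> discrepancy_le 1 (L `&` `]u, v[%classic).
Proof.
move=> uv Mu vM cL.
have [->|/set0P[x [Lx]]] := eqVneq (L `&` `]u, v[%classic) set0.
  by apply: discrepancy_leW discrepancy_le0.
rewrite /= in_itv/= => /andP[ux xv].
suff -> : L `&` `]u, v[ = `]u, v[%classic by exact: discrepancy_le_itv.
apply: setIidr => y /=; rewrite in_itv/= => /andP[uy yv].
by have [xy|yx] := leP x y; [apply/(cL x y)|apply/(cL y x) => //; exact: ltW].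
Qed.

(** Induction on the break points: cutting at the least one, [r], gives an interval on which [L] is
    all or nothing and the point [r], each costing 1, and a rest with one break point fewer. *)
Lemma discrepancy_le_const_sorted L s u v : u <= v -> - M%:R <= Q * u -> Q * v <= M%:R ->
  path <%R u s -> all (< v) s -> const_off L s u v ->
  discrepancy_le (2 * (size s)%:R + 1) (L `&` `]u, v[%classic).
Proof.
elim: s u => [|r s IH] u uv Mu vM /=.
  by move=> _ _ cL; rewrite mulr0 add0r; exact: discrepancy_le_const0.
move=> /andP[ur srt] /andP[rv sv] cL.
have Qur : Q * u <= Q * r by rewrite ler_pM2l// ltW.
have Qrv : Q * r <= Q * v by rewrite ler_pM2l// ltW.
have rs r' : r' \in s -> r < r'.
  by move: r'; apply/allP; exact: order_path_min lt_trans srt.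
have c1 : discrepancy_le 1 (L `&` `]u, r[%classic).
  apply: discrepancy_le_const0 => //; [exact: ltW|exact: le_trans Qrv vM|].
  move=> x y ux xy yr _; apply: cL => //; first exact: lt_trans yr rv.
  move=> r'; rewrite inE negb_and -!ltNge => /orP[/eqP ->|/rs rr'].
    by rewrite yr orbT.
  by rewrite (lt_trans yr rr') orbT.
have c2 : discrepancy_le (2 * (size s)%:R + 1) (L `&` `]r, v[%classic).
  apply: IH => //; [exact: ltW|exact: le_trans Mu Qur|].
  move=> x y rx xy yv xys; apply: cL => //; first exact: lt_trans ur rx.
  by move=> r'; rewrite inE => /orP[/eqP ->|/xys//]; rewrite leNgt rx.
have c3 : discrepancy_le 1 (L `&` [set r]).
  have [Lr|Lr] := pselect (L r).
    by rewrite setIidr//; [exact: discrepancy_le1|move=> _ ->].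
  suff -> : L `&` [set r] = set0 by apply: discrepancy_leW discrepancy_le0.
  by rewrite -subset0 => x [Lx xr]; apply: Lr; rewrite -xr.
have -> : L `&` `]u, v[ = (L `&` `]u, r[) `|` ((L `&` [set r]) `|` (L `&` `]r, v[)).
  rewrite -!setIUr; congr (L `&` _); apply/seteqP; split => x /=; rewrite !in_itv/=.
    by move=> /andP[-> ->]/=; case: (ltgtP x r) => [|_|->]; [left|right; right|right; left].
  case=> [/andP[-> xr]|[->|/andP[rx ->]]]; first by rewrite (lt_trans xr).
    by rewrite ur.
  by rewrite (lt_trans ur).
apply: discrepancy_leW (discrepancy_leU _ c1 (discrepancy_leU _ c3 c2)).
- by rewrite -natr1; lra.
- rewrite -subset0 => x [[_ /=]]; rewrite in_itv/= => /andP[_ xr] [[_ xE]|[_ /=]].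
    by move: xr; rewrite xE ltxx.
  by rewrite in_itv/= => /andP[/(lt_trans xr)]; rewrite ltxx.
- by rewrite -subset0 => x [[_ ->] [_]] /=; rewrite in_itv/= ltxx.
Qed.

Lemma discrepancy_le_const L s B : 0 <= B -> Q * B < M%:R -> L `<=` `[- B, B] ->
  (forall x y, x <= y -> (forall r, r \in s -> ~~ (x <= r <= y)) -> L x <-> L y) ->
  discrepancy_le (2 * (size s)%:R + 1) L.
Proof.
move=> B0 BM LB cL; pose v := M%:R / Q.
have Qv : Q * v = M%:R by rewrite /v mulrC divfK// gt_eqF.
have v0 : 0 <= v by rewrite divr_ge0// ltW.
(* Break points outside the window []- v, v[], which contains [L], are dropped. *)
pose s' := sort <=%R (undup [seq r <- s | - v < r < v]).
have -> : L = L `&` `]- v, v[%classic.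
  apply/esym/setIidl => x /LB/=; rewrite !in_itv/=.
  have Bv : B < v by rewrite /v ltr_pdivlMr// mulrC.
  by move=> /andP[Bx xB]; apply/andP; split; lra.
apply: (@discrepancy_leW (2 * (size s')%:R + 1)).
  rewrite lerD2r ler_pM2l// ler_nat size_sort (leq_trans (size_undup _))//.
  by rewrite size_filter count_size.
have mems' r : r \in s' = (- v < r < v) && (r \in s).
  by rewrite mem_sort mem_undup mem_filter.
apply: discrepancy_le_const_sorted; rewrite ?mulrN ?Qv//.
- by rewrite (le_trans _ v0)// oppr_le0.
- rewrite path_sortedE; last exact: lt_trans.
  rewrite sort_lt_sorted undup_uniq andbT.
  by apply/allP => r; rewrite mems' => /andP[/andP[]].
- by apply/allP => r; rewrite mems' => /andP[/andP[]].
move=> x y vx xy yv xys; apply: cL => // r rs.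
apply/negP => /[dup] /andP[xr ry]; apply/negP/xys.
by rewrite mems' rs (lt_le_trans vx xr) (le_lt_trans ry yv).
Qed.

End Discrepancy.

(** * Counting in product spaces *)

Section Slab.
Context {R : realType} d (T : measurableType d).
Variables (mu : {sigma_finite_measure set T -> \bar R}) (Q : R) (M : nat).
Hypothesis Q_gt0 : 0 < Q.
Local Notation leb := (@lebesgue_measure R).
Local Notation point := (measurableTypeR R).

(** The sum of the [m i] is the integral over [t] of the number of grid points in [ysection W t],
    and [Q * l] is that of [Q] times its length. The integrands differ by at most [k] on [D] and
    both vanish outside. *)
Lemma discrepancy_le_prod (W : set (point * T)) (D : set T) (b k : R) (m : nat -> R) :
  measurable W -> measurable D -> mu D = b%:E -> 0 <= k ->
  (forall t, D t -> discrepancy_le Q M k (ysection W t)) ->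
  (forall t, ~ D t -> ysection W t = set0) ->
  (forall i, mu (xsection W (grid Q M i)) = (m i)%:E) ->
  exists2 l : R, (leb \x mu)%E W = l%:E &
    `|\sum_(i < M.*2.+1) m i - Q * l| <= k * b.
Proof.
move=> mW mD muD k0 WD WnD Wm.
pose f (t : T) : \bar R := (\sum_(i < M.*2.+1) (\1_(xsection W (grid Q M i)) t)%:E)%E.
pose g (t : T) : \bar R := leb (ysection W t).
have fE t : f t = (grid_count Q M (ysection W t))%:E.
  rewrite /f /grid_count sumEFin; congr EFin; exact: eq_bigr.
have bound t : (f t <= Q%:E * g t + k%:E * (\1_D t)%:E)%E /\
    (Q%:E * g t <= f t + k%:E * (\1_D t)%:E)%E.
  rewrite fE /g indicE; have [Dt|Dt] := pselect (D t).
    have [_ [l -> ]] := WD _ Dt; rewrite mem_set// ler_distl => /andP[h1 h2].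
    by rewrite -!EFinM -!EFinD !lee_fin mulr1; split; lra.
  rewrite memNset// WnD// /grid_count big1 => [|i _]; last by rewrite indicE in_set0.
  by rewrite measure0 !mule0 adde0.
have mx i : measurable (xsection W (grid Q M i)) by exact: measurable_xsection.
have f0 t : (0 <= f t)%E by rewrite /f; apply: sume_ge0 => i _; rewrite lee_fin indicE.
have mf : measurable_fun setT (f : T -> \bar R).
  apply: emeasurable_sum => i; apply/measurable_EFinP.
  exact: measurable_indic.
have mg : measurable_fun setT (g : T -> \bar R) by exact: measurable_fun_ysection.
have g0 t : (0 <= g t)%E by exact: measure_ge0.
have intf : (\int[mu]_t f t = (\sum_(i < M.*2.+1) m i)%:E)%E.
  rewrite ge0_integral_sum//=.
  - rewrite -sumEFin; apply: eq_bigr => i _.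
    rewrite integral_indic// setIT; exact: Wm.
  - by move=> i; apply/measurable_EFinP; exact: measurable_indic.
(* The product measure has its outer integral over the first factor; uniqueness of the product
   measure exchanges the order. *)
have intg : ((leb \x mu) W = \int[mu]_t g t)%E.
  rewrite (@product_measure_unique _ _ _ _ _ leb mu (leb \x^ mu)%E)// => A1 A2 mA1 mA2.
  exact: product_measure2E.
have mi : measurable_fun setT (fun t => (\1_D t)%:E : \bar R).
  by apply/measurable_EFinP; exact: measurable_indic.
have inti : (\int[mu]_t (k%:E * (\1_D t)%:E) = (k * b)%:E)%E.
  rewrite ge0_integralZl_EFin//=.
  by rewrite integral_indic// setIT EFinM -muD.
have ki t : (0 <= k%:E * (\1_D t)%:E)%E by rewrite mule_ge0// lee_fin// indicE.
have mki : measurable_fun setT (fun t => k%:E * (\1_D t)%:E)%E by exact: measurable_funeM.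
have Qg t : (0 <= Q%:E * g t)%E by rewrite mule_ge0// lee_fin ltW.
have mQg : measurable_fun setT (fun t => Q%:E * g t)%E by exact: measurable_funeM.
have intQg : (\int[mu]_t (Q%:E * g t) = Q%:E * \int[mu]_t g t)%E.
  by rewrite ge0_integralZl_EFin// ltW.
have h1 : (\int[mu]_t f t <= Q%:E * \int[mu]_t g t + (k * b)%:E)%E.
  rewrite -intQg -inti -ge0_integralD//; apply: ge0_le_integral => //.
  - exact: emeasurable_funD.
  - by move=> t _; have [] := bound t.
have h2 : (Q%:E * \int[mu]_t g t <= \int[mu]_t f t + (k * b)%:E)%E.
  rewrite -intQg -inti -ge0_integralD//; apply: ge0_le_integral => //.
  - exact: emeasurable_funD.
  - by move=> t _; have [] := bound t.
have ig0 : (0 <= \int[mu]_t g t)%E by exact: integral_ge0.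
move: h1 h2 ig0; rewrite intg intf; case: (\int[mu]_t g t)%E => [l| |] //.
- rewrite -!EFinM -!EFinD !lee_fin => h1 h2 _; exists l => //.
  by rewrite ler_distl; apply/andP; split; lra.
(* An infinite integral would contradict [h2], whose right side would stay finite. *)
- by rewrite gt0_muley ?lte_fin// -EFinD.
Qed.

End Slab.

(** * Sets tame along axis-parallel lines, and their lattice points *)

Section Tame.
Context {R : realType}.
Local Notation point d := (d.-tuple (measurableTypeR R)).

Definition upd d (a : d.-tuple R) (i : 'I_d) (x : R) : d.-tuple R :=
  [tuple if j == i then x else tnth a j | j < d].

(** Bounding the changes along a line, rather than the number of intervals, makes complements free
    and intersections additive. The break points may depend on the line, the bound on their number
    may not. *)
Definition tame d (C : nat) (A : set (point d)) := measurable A /\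
  forall (a : d.-tuple R) (i : 'I_d), exists2 s : seq R, (size s <= C)%N &
    forall x y, x <= y -> (forall r, r \in s -> ~~ (x <= r <= y)) ->
      A (upd a i x) <-> A (upd a i y).

Lemma tameI d C1 C2 (A1 A2 : set (point d)) :
  tame C1 A1 -> tame C2 A2 -> tame (C1 + C2) (A1 `&` A2).
Proof.
move=> [m1 t1] [m2 t2]; split=> [|a i]; first exact: measurableI.
have [s1 s1C c1] := t1 a i; have [s2 s2C c2] := t2 a i.
exists (s1 ++ s2); first by rewrite size_cat leq_add.
move=> x y xy xys.
have A1xy : A1 (upd a i x) <-> A1 (upd a i y).
  by apply: c1 => // r rs; apply: xys; rewrite mem_cat rs.
have A2xy : A2 (upd a i x) <-> A2 (upd a i y).
  by apply: c2 => // r rs; apply: xys; rewrite mem_cat rs orbT.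
by rewrite /setI/=; split => -[? ?]; split; tauto.
Qed.

Lemma tameC d C (A : set (point d)) : tame C A -> tame C (~` A).
Proof.
move=> [mA tA]; split=> [|a i]; first exact: measurableC.
have [s sC c] := tA a i; exists s => // x y xy /(c _ _ xy) A12.
by rewrite /setC/=; tauto.
Qed.

Lemma tameT d : tame 0 (setT : set (point d)).
Proof. by split=> // a i; exists [::]. Qed.

Lemma tame_bigcap d C (I : finType) (F : I -> set (point d)) :
  (forall i, tame C (F i)) -> tame (#|I| * C) [set a | forall i, F i a].
Proof.
move=> tF; rewrite cardE.
suff H (s : seq I) : tame (size s * C) [set a | forall i, i \in s -> F i a].
  have -> : [set a | forall i, F i a] = [set a | forall i, i \in enum I -> F i a].
    by apply/seteqP; split=> [a h i _|a h i]; apply: h; rewrite ?mem_enum.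
  exact: H.
elim: s => [|j s IH].
  have -> : [set a | forall i, i \in [::] -> F i a] = setT.
    by apply/seteqP; split.
  exact: tameT.
have -> : [set a | forall i, i \in j :: s -> F i a] =
    F j `&` [set a | forall i, i \in s -> F i a].
  apply/seteqP; split=> [a h|a [h1 h2] i]; last first.
    by rewrite inE => /orP[/eqP ->|/h2].
  split; first by apply: h; rewrite inE eqxx.
  by move=> i si; apply: h; rewrite inE si orbT.
by rewrite mulSn; exact: tameI.
Qed.

Lemma tnth_tuple_cons d x (t : point d) :
  (tnth (tuple_cons (x, t)) ord0 = x) *
  (forall i, tnth (tuple_cons (x, t)) (lift ord0 i) = tnth t i).
Proof. by split=> [//|i]; rewrite /tuple_cons/= tnthS. Qed.

Lemma upd_cons0 d x y (t : point d) :
  upd (tuple_cons (x, t)) ord0 y = tuple_cons (y, t).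
Proof.
apply: eq_from_tnth => j; rewrite tnth_mktuple.
by case: (unliftP ord0 j) => [k ->|->]; rewrite ?eqxx !tnth_tuple_cons.
Qed.

Lemma upd_consS d x y (t : point d) i :
  upd (tuple_cons (x, t)) (lift ord0 i) y = tuple_cons (x, upd t i y).
Proof.
apply: eq_from_tnth => j; rewrite tnth_mktuple.
case: (unliftP ord0 j) => [k ->|->]; rewrite !tnth_tuple_cons ?tnth_mktuple//.
Qed.

Section Lattice.
Variables (Q B : R) (M C : nat).
Hypotheses (Q_gt0 : 0 < Q) (B_ge0 : 0 <= B) (QBM : Q * B < M%:R).

Definition grid_point d (c : d.-tuple 'I_M.*2.+1) : d.-tuple R :=
  [tuple grid Q M (tnth c j) | j < d].

Definition lattice_count d (A : set (point d)) : R :=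
  \sum_(c : d.-tuple 'I_M.*2.+1) \1_A (grid_point c).

Lemma lattice_countS d (A : set (point d.+1)) : lattice_count A =
  \sum_(i < M.*2.+1) lattice_count (xsection (@tuple_cons R d @^-1` A) (grid Q M i)).
Proof.
rewrite pair_big/= /lattice_count.
rewrite (reindex (fun p : 'I_M.*2.+1 * d.-tuple 'I_M.*2.+1 => [tuple of p.1 :: p.2])) /=.
  apply: eq_bigr => -[i c] _ /=; rewrite !indicE; congr (nat_of_bool _)%:R.
  rewrite /xsection/=.
  have -> : grid_point [tuple of i :: c] = tuple_cons (grid Q M i, grid_point c).
    apply: eq_from_tnth => j; rewrite tnth_mktuple.
    case: (unliftP ord0 j) => [k ->|->]; rewrite tnth_tuple_cons//.
    by rewrite tnth_mktuple tnthS.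
  by apply/idP/idP; rewrite !inE/= ?inE.
exists (fun c : d.+1.-tuple 'I_M.*2.+1 => (thead c, [tuple of behead c])).
  by move=> [i c] _ /=; rewrite theadE; congr pair; apply: val_inj.
by move=> c _ /=; rewrite [RHS]tuple_eta.
Qed.

(* Passing from [d] to [d + 1]: the second term is the error of the sections over
   the grid points of the first coordinate, the first one that of replacing the
   sum over this coordinate by an integral. *)
Fixpoint lattice_err d : R :=
  if d is d'.+1
  then Q ^+ d' * ((2 * C%:R + 1) * (2 * B) ^+ d') + M.*2.+1%:R * lattice_err d'
  else 0.

(** Induction on [d], splitting off the first coordinate. The sections at its grid values are tame
    with the same [C], because their axis-parallel lines are lines for [A]; the lines in the first
    direction satisfy the one-dimensional estimate. *)
Lemma lattice_count_approx d (A : set (point d)) : tame C A ->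
  (forall t, A t -> forall i, `|tnth t i| <= B) ->
  exists2 l : R, lebesgue_tuple R d A = l%:E &
    `|lattice_count A - Q ^+ d * l| <= lattice_err d.
Proof.
elim: d A => [|d IH] A [mA tA] AB.
  (* In dimension 0 the measure is a point mass, so that count and measure agree exactly. *)
  exists (\1_A [tuple]); first by rewrite /= diracE indicE.
  rewrite /lattice_count (big_pred1 [tuple]) => [|c]; last by rewrite (tuple0 c); apply/esym/eqP.
  have -> : grid_point [tuple] = [tuple] by apply: eq_from_tnth => -[].
  by rewrite expr0 mul1r subrr normr0.
pose W := @tuple_cons R d @^-1` A.
have mW : measurable W.
  by rewrite -[W]setTI; exact: measurable_tuple_cons.
have tW x : tame C (xsection W x).
  split=> [|a i]; first exact: measurable_xsection.
  have [s sC c] := tA (tuple_cons (x, a)) (lift ord0 i); exists s => //.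
  by move=> y z yz /(c _ _ yz); rewrite !upd_consS /xsection/= !inE.
have WB x t : xsection W x t -> forall i, `|tnth t i| <= B.
  rewrite /xsection/= inE => /AB h i.
  by have := h (lift ord0 i); rewrite tnth_tuple_cons.
pose m (i : nat) : R := fine (lebesgue_tuple R d (xsection W (grid Q M i))).
have mE i : lebesgue_tuple R d (xsection W (grid Q M i)) = (m i)%:E.
  by have [l lE _] := IH _ (tW (grid Q M i)) (@WB _); rewrite /m lE.
have mapx i : `|lattice_count (xsection W (grid Q M i)) - Q ^+ d * m i| <= lattice_err d.
  by have [l lE] := IH _ (tW (grid Q M i)) (@WB _); rewrite /m lE.
pose a := [tuple of nseq d (- B)]; pose b := [tuple of nseq d B].
(* Outside this box the sections in the first direction are empty, so the one-dimensional error is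
   integrated over volume [(2 * B) ^+ d] only. *)
pose D := [set t : point d | forall i, tnth a i <= tnth t i <= tnth b i].
have muD : lebesgue_tuple R d D = ((2 * B) ^+ d)%:E.
  rewrite lebesgue_tuple_box.
    congr EFin; rewrite -[d in RHS]card_ord -prodr_const; apply: eq_bigr => i _.
    by rewrite !tnth_nseq; ring.
  by move=> i; rewrite !tnth_nseq ge0_cp.
have mD : measurable D.
  have -> : D = \bigcap_(i in [set: 'I_d])
      ((fun t : point d => tnth t i) @^-1` `[- B, B]%classic).
    apply/seteqP; split=> [t h i _ /=|t h i]; first by have := h i; rewrite !tnth_nseq in_itv.
    by have := h i Logic.I; rewrite !tnth_nseq/= in_itv.
  apply: fin_bigcap_measurable => // i _.
  by rewrite -[X in measurable X]setTI; exact: measurable_tnth.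
have k0 : 0 <= 2 * C%:R + 1 :> R by rewrite addr_ge0// mulr_ge0.
have WD t : D t -> discrepancy_le Q M (2 * C%:R + 1) (ysection W t).
  move=> _; have [s sC c] := tA (tuple_cons (0, t)) ord0.
  apply: (@discrepancy_leW _ Q M (2 * (size s)%:R + 1)).
    by rewrite lerD2r ler_pM2l// ler_nat.
  apply: (@discrepancy_le_const _ Q M Q_gt0 _ s B) => //.
    move=> x; rewrite /ysection/= inE => /AB/(_ ord0).
    by rewrite tnth_tuple_cons in_itv/= -ler_norml.
  by move=> x y xy /(c _ _ xy); rewrite !upd_cons0 /ysection/= !inE.
have WnD t : ~ D t -> ysection W t = set0.
  move=> nDt; rewrite -subset0 => x; rewrite /ysection/= inE => /AB h; apply: nDt => i.
  by have := h (lift ord0 i); rewrite tnth_tuple_cons !tnth_nseq ler_norml.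
have [l Wl Wml] := discrepancy_le_prod Q_gt0 mW mD muD k0 WD WnD mE.
exists l; first exact: Wl.
rewrite lattice_countS -/W.
have -> : \sum_(i < M.*2.+1) lattice_count (xsection W (grid Q M i)) - Q ^+ d.+1 * l =
    Q ^+ d * (\sum_(i < M.*2.+1) m i - Q * l) +
    \sum_(i < M.*2.+1) (lattice_count (xsection W (grid Q M i)) - Q ^+ d * m i).
  by rewrite sumrB -mulr_sumr exprS; ring.
apply: (le_trans (ler_normD _ _)) => /=; apply: lerD.
  rewrite normrM (ger0_norm (exprn_ge0 _ (ltW Q_gt0))) ler_pM2l//.
  by rewrite exprn_gt0.
apply: (le_trans (ler_norm_sum _ _ _)).
apply: (@le_trans _ _ (\sum_(i < M.*2.+1) lattice_err d)).
  by apply: ler_sum => i _; exact: mapx.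
by rewrite sumr_const card_ord mulr_natl.
Qed.

End Lattice.
End Tame.

(** * Rational functions of the coefficients *)

Section PolyFun.
Context {R : realType}.
Local Notation point d := (d.-tuple (measurableTypeR R)).

(** Polynomial in each variable separately, of degree below [s], which is all that [tame] looks at
    apart from measurability. *)
Definition polyfun d (s : nat) (f : d.-tuple R -> R) :=
  measurable_fun [set: point d] (f : point d -> R) /\
  forall a i, exists2 p : {poly R}, (size p <= s)%N &
    forall t, f (upd a i t) = p.[t].

Lemma polyfun_cst d c : @polyfun d 1 (fun=> c).
Proof.
split=> [|a i]; first exact: measurable_cst.
by exists c%:P => [|t]; rewrite ?hornerC// size_polyC leq_b1.
Qed.

Lemma polyfun_tnth d j : @polyfun d 2 (fun a => tnth a j).
Proof.
split=> [|a i]; first exact: measurable_tnth.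
have [<-|ij] := eqVneq j i.
  by exists 'X => [|t]; rewrite ?size_polyX// tnth_mktuple eqxx hornerX.
exists (tnth a j)%:P => [|t]; first by rewrite (leq_trans (size_polyC_leq1 _)).
by rewrite tnth_mktuple (negbTE ij) hornerC.
Qed.

Lemma polyfunD d s1 s2 (f1 f2 : d.-tuple R -> R) :
  polyfun s1 f1 -> polyfun s2 f2 -> polyfun (s1 + s2) (fun a => f1 a + f2 a).
Proof.
move=> [m1 p1] [m2 p2]; split=> [|a i]; first exact: measurable_funD.
have [q1 sq1 E1] := p1 a i; have [q2 sq2 E2] := p2 a i.
exists (q1 + q2) => [|t]; last by rewrite hornerD E1 E2.
rewrite (leq_trans (size_polyD _ _))// geq_max.
by rewrite (leq_trans sq1) ?leq_addr// (leq_trans sq2) ?leq_addl.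
Qed.

Lemma polyfunM d s1 s2 (f1 f2 : d.-tuple R -> R) :
  polyfun s1 f1 -> polyfun s2 f2 -> polyfun (s1 + s2) (fun a => f1 a * f2 a).
Proof.
move=> [m1 p1] [m2 p2]; split=> [|a i]; first exact: measurable_funM.
have [q1 sq1 E1] := p1 a i; have [q2 sq2 E2] := p2 a i.
exists (q1 * q2) => [|t]; last by rewrite hornerM E1 E2.
rewrite (leq_trans (size_polyMleq _ _))// (leq_trans (leq_pred _))//.
exact: leq_add.
Qed.

Lemma polyfunX d s (f : d.-tuple R -> R) N :
  polyfun s f -> polyfun (1 + N * s) (fun a => f a ^+ N).
Proof.
move=> pf; elim: N => [|N IH]; first exact: (polyfun_cst _ 1).
have -> : (fun a => f a ^+ N.+1) = (fun a => f a * f a ^+ N).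
  by apply/funext => a; rewrite exprS.
by rewrite mulSn addnCA; exact: polyfunM.
Qed.

(** The break points on a line are the roots of the restricted polynomial: between them its sign is
    constant by the intermediate value theorem. If it vanishes identically, nothing changes along
    the line. *)
Lemma tame_polyfun d s (f : d.-tuple R -> R) :
  polyfun s f -> tame s ([set a | 0 <= f a] : set (point d)).
Proof.
move=> [mf pf]; split.
  have -> : [set a | 0 <= f a] = f @^-1` `[0, +oo[%classic.
    by apply/seteqP; split=> a /=; rewrite in_itv/= andbT.
  by rewrite -[X in measurable X]setTI; exact: mf.
move=> a i; have [p sp fE] := pf a i.
exists (rootsR p) => [|x y xy xyr].
  have [->|p0] := eqVneq p 0; first by rewrite rootsR0.
  rewrite (leq_trans _ sp)// ltnW// max_poly_roots ?uniq_roots//.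
  by apply/allP => z; rewrite -(roots_on_rootsR p0) => /andP[].
rewrite /= !fE; have [->|p0] := eqVneq p 0; first by rewrite !horner0.
have noroot z : x <= z <= y -> ~~ root p z.
  by move=> xzy; apply/negP => rz; move: (xyr z);
    rewrite -(roots_on_rootsR p0) in_itv/= rz xzy => /(_ isT).
have h : 0 < p.[x] * p.[y].
  rewrite ltNge; apply/negP => /(polyrcf.poly_ivt xy)[z]; rewrite in_itv => /noroot.
  by move=> /negP.
by split=> h0; [rewrite -(pmulr_rge0 _ (_ : 0 < p.[x]))|rewrite -(pmulr_lge0 _ (_ : 0 < p.[y]))];
  rewrite ?ltW// lt_neqAle h0 andbT eq_sym; apply: contraTneq h => ->; rewrite ?mul0r ?mulr0 ltxx.
Qed.

Variable n : nat.
Implicit Types f : n.+1.-tuple R -> R.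
Local Notation lc a := (tnth a ord_max).

(* Polynomials divided by a power of the leading coefficient; the value where the
   latter vanishes is irrelevant. *)
Definition ratfun f := exists N s g, @polyfun n.+1 s g /\
  forall a : n.+1.-tuple R, lc a != 0 -> g a = lc a ^+ N * f a.

Lemma polyfun_ratfun s f : polyfun s f -> ratfun f.
Proof. by move=> pf; exists 0%N, s, f; split=> // a _; rewrite expr0 mul1r. Qed.

Lemma ratfun_cst c : ratfun (fun=> c).
Proof. exact/polyfun_ratfun/polyfun_cst. Qed.

Lemma ratfun_div i : ratfun (fun a => tnth a i / lc a).
Proof.
exists 1%N, 2%N, (fun a => tnth a i); split; first exact: polyfun_tnth.
by move=> a a0; rewrite expr1 mulrC divfK.
Qed.

Lemma ratfunM f1 f2 : ratfun f1 -> ratfun f2 -> ratfun (fun a => f1 a * f2 a).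
Proof.
move=> [N1 [s1 [g1 [p1 E1]]]] [N2 [s2 [g2 [p2 E2]]]].
exists (N1 + N2)%N, (s1 + s2)%N, (fun a => g1 a * g2 a); split; first exact: polyfunM.
by move=> a a0; rewrite E1// E2// mulrACA exprD.
Qed.

Lemma ratfunD f1 f2 : ratfun f1 -> ratfun f2 -> ratfun (fun a => f1 a + f2 a).
Proof.
move=> [N1 [s1 [g1 [p1 E1]]]] [N2 [s2 [g2 [p2 E2]]]].
have pX N := polyfunX N (@polyfun_tnth n.+1 ord_max).
exists (N1 + N2)%N, (s1 + (1 + N2 * 2) + (s2 + (1 + N1 * 2)))%N,
  (fun a => g1 a * lc a ^+ N2 + g2 a * lc a ^+ N1); split.
  by apply: polyfunD; apply: polyfunM; [exact: p1|exact: pX|exact: p2|exact: pX].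
by move=> a a0; rewrite E1// E2// exprD; ring.
Qed.

Lemma ratfun_sum (I : Type) (r : seq I) (F : I -> n.+1.-tuple R -> R) :
  (forall i, ratfun (F i)) -> ratfun (fun a => \sum_(i <- r) F i a).
Proof.
move=> rF; elim: r => [|i r IH].
  have -> : (fun a => \sum_(i <- [::]) F i a) = (fun=> 0).
    by apply/funext => a; rewrite big_nil.
  exact: ratfun_cst.
have -> : (fun a => \sum_(i <- i :: r) F i a) = (fun a => F i a + \sum_(i <- r) F i a).
  by apply/funext => a; rewrite big_cons.
exact: ratfunD.
Qed.

Lemma ratfun_prod (I : Type) (r : seq I) (F : I -> n.+1.-tuple R -> R) :
  (forall i, ratfun (F i)) -> ratfun (fun a => \prod_(i <- r) F i a).
Proof.
move=> rF; elim: r => [|i r IH].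
  have -> : (fun a => \prod_(i <- [::]) F i a) = (fun=> 1).
    by apply/funext => a; rewrite big_nil.
  exact: ratfun_cst.
have -> : (fun a => \prod_(i <- i :: r) F i a) = (fun a => F i a * \prod_(i <- r) F i a).
  by apply/funext => a; rewrite big_cons.
exact: ratfunM.
Qed.

Lemma ratfunX f k : ratfun f -> ratfun (fun a => f a ^+ k).
Proof.
move=> rf; elim: k => [|k IH]; first exact: (ratfun_cst 1).
have -> : (fun a => f a ^+ k.+1) = (fun a => f a * f a ^+ k).
  by apply/funext => a; rewrite exprS.
exact: ratfunM.
Qed.

(* Uniformity in [c] is what makes the count uniform in the discriminant bound. *)
Lemma ratfun_le f : ratfun f -> exists C, forall c,
  tame C ([set a | lc a != 0 /\ f a <= c] : set (point n.+1)).
Proof.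
move=> [N [s [g [pg gE]]]].
have pX k := polyfunX k (@polyfun_tnth n.+1 ord_max).
have t0 : tame (1 + (1 + 2 * 2)) [set a : point n.+1 | lc a != 0].
  have -> : [set a : point n.+1 | lc a != 0] = ~` [set a | 0 <= -1 * lc a ^+ 2].
    apply/seteqP; split=> a /=; rewrite mulN1r oppr_ge0.
      by move=> a0; apply/negP; rewrite -ltNge exprn_even_gt0.
    by move=> /negP; rewrite -ltNge exprn_even_gt0.
  apply: tameC; apply: tame_polyfun; apply: polyfunM; first exact: polyfun_cst.
  exact: pX.
exists (1 + (1 + 2 * 2) + ((1 + (1 + (N + N) * 2)) + (1 + ((1 + N * 2) + s))))%N => c.
(* Multiplication by the even power [lc a ^+ (N + N)] clears denominators without reversing the
   inequality; [c] enters only as a constant factor, so no degree depends on it. *)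
have -> : [set a : point n.+1 | lc a != 0 /\ f a <= c] =
    [set a : point n.+1 | lc a != 0] `&`
    [set a | 0 <= c * lc a ^+ (N + N) + (-1) * (lc a ^+ N * g a)].
  apply/seteqP; split=> a /=; move=> [a0 h]; split=> //; move: h;
   rewrite gE// mulN1r subr_ge0 mulrA -exprD mulrC ler_pM2r// exprD -expr2;
   by rewrite exprn_even_gt0// expf_neq0.
apply: tameI; first exact: t0.
apply: tame_polyfun; apply: polyfunD.
  by apply: polyfunM; [exact: polyfun_cst|exact: pX].
apply: polyfunM; first exact: polyfun_cst.
by apply: polyfunM; [exact: pX|exact: pg].
Qed.

End PolyFun.

(** * Symmetric functions of the roots *)

Section Symmetric.
Context {R : realType}.
Local Notation C := R[i].
Local Notation RC := (real_complex R).
Local Notation point d := (d.-tuple (measurableTypeR R)).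

Definition lcoef n (a : n.+1.-tuple R) : R := tnth a ord_max.

(** The roots come in any order, so only symmetric functions of [al] are functions of [a]. *)
Definition root_tuple n (a : n.+1.-tuple R) (al : n.-tuple C) :=
  complex_poly (Poly a) = RC (lcoef a) *: \prod_(z <- al) ('X - z%:P).

(** Vieta's formulas, solved for the elementary symmetric functions. *)
Lemma mesym_root_tuple n (a : n.+1.-tuple R) (al : n.-tuple C) (k : 'I_n) :
  lcoef a != 0 -> root_tuple a al ->
  meval (tnth al) (mesym n C k.+1) =
  RC ((-1) ^+ k.+1 * (tnth a (inord (n - k.+1)) / lcoef a)).
Proof.
move=> a0 /(congr1 (fun p : {poly C} => p`_(n - k.+1))).
have kn : (k.+1 < n.+1)%N by rewrite ltnS.
rewrite coefZ (mroots_coeff al (Ordinal kn)) /= coef_map coef_Poly /= => E.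
rewrite rmorphM rmorphXn rmorphN1 fmorph_div/=.
have -> : tnth a (inord (n - k.+1)) = a`_(n - k.+1).
  by rewrite (tnth_nth 0) inordK// ltnS leq_subr.
rewrite E mulrAC divff ?fmorph_eq0// mul1r mulrA -expr2 -exprM mulnC exprM sqrrN.
by rewrite !expr1n mul1r.
Qed.

(** By the fundamental theorem [F] is a polynomial [t] in the elementary symmetric ones, whose
    values are rational in [a] by Vieta. These values are real, so taking real parts only affects
    the coefficients of [t]. *)
Lemma ratfun_sym n (F : mpoly n C) : F \is mpoly.symmetric ->
  exists2 f : n.+1.-tuple R -> R, ratfun f &
    forall (a : n.+1.-tuple R) (al : n.-tuple C),
      lcoef a != 0 -> root_tuple a al ->
      complex.Re (meval (tnth al) F) = f a.
Proof.
move=> /sym_fundamental[t [<- _]].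
pose e i (a : n.+1.-tuple R) := (-1) ^+ i.+1 * (tnth a (inord (n - i.+1)) / lcoef a).
exists (fun a => \sum_(m <- msupp t) complex.Re (mcoeff m t) *
    \prod_(i <- index_enum 'I_n) e i a ^+ m i).
  apply: ratfun_sum => m; apply: ratfunM; first exact: ratfun_cst.
  apply: ratfun_prod => i; apply: ratfunX; apply: ratfunM; first exact: ratfun_cst.
  exact: ratfun_div.
move=> a al a0 aal; rewrite comp_mpoly_meval mevalE raddf_sum/=.
apply: eq_bigr => m _.
have -> : \prod_(i < n) meval (tnth al) (tnth [tuple mesym n C i.+1 | i < n] i) ^+ m i =
    RC (\prod_(i <- index_enum 'I_n) e i a ^+ m i).
  rewrite rmorph_prod; apply: eq_bigr => i _; rewrite rmorphXn tnth_mktuple.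
  by rewrite (mesym_root_tuple _ a0 aal).
case: (mcoeff m t) => x y; set r := \prod_(i <- _) _.
by rewrite /= mulr0 subr0.
Qed.

Lemma msymXU n (s : {perm 'I_n}) (i : 'I_n) :
  msym s (mpolyX C (mnm1 i)) = mpolyX C (mnm1 (s i)).
Proof. by rewrite /msym mmapX mmap1U. Qed.

Lemma coef_symmetric n (W : {poly mpoly n C}) :
  (forall s : {perm 'I_n}, map_poly (msym s) W = W) ->
  forall k, W`_k \is mpoly.symmetric.
Proof.
move=> sW k; apply/issymP => s.
by rewrite -[in RHS](sW s) coef_map.
Qed.

Local Notation Xi i := (mpolyX C (mnm1 i)).

(** Taking all ordered pairs, the diagonal included, makes permutation invariance a reindexing. The
    ring is arbitrary so that the formula serves for indeterminates and for roots alike. *)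
Definition sqdiff_poly (A : comNzRingType) n (v : 'I_n -> A) : {poly A} :=
  \prod_(i < n) \prod_(j < n) ('X + ((v i - v j) ^+ 2)%:P).

Lemma map_sqdiff_poly (A B : comNzRingType) (f : {rmorphism A -> B}) n (v : 'I_n -> A) :
  map_poly f (sqdiff_poly v) = sqdiff_poly (f \o v).
Proof.
rewrite /sqdiff_poly rmorph_prod; apply: eq_bigr => i _; rewrite rmorph_prod.
apply: eq_bigr => j _.
by rewrite rmorphD/= map_polyX map_polyC/= rmorphXn rmorphB.
Qed.

Lemma sqdiff_poly_perm (A : comNzRingType) n (v : 'I_n -> A) (s : {perm 'I_n}) :
  sqdiff_poly (v \o s) = sqdiff_poly v.
Proof.
rewrite /sqdiff_poly [RHS](reindex_perm s)/=; apply: eq_bigr => i _.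
by rewrite [RHS](reindex_perm s).
Qed.

(** Bounding its roots bounds all subset products of [v] at once, as the Mahler measure requires;
    squares stand in for absolute values, which are not polynomial. *)
Definition subset_poly (A : comNzRingType) n (v : 'I_n -> A) : {poly A} :=
  \prod_(I : {set 'I_n}) ('X - ((\prod_(i in I) v i) ^+ 2)%:P).

Lemma map_subset_poly (A B : comNzRingType) (f : {rmorphism A -> B}) n (v : 'I_n -> A) :
  map_poly f (subset_poly v) = subset_poly (f \o v).
Proof.
rewrite /subset_poly rmorph_prod; apply: eq_bigr => I _.
by rewrite rmorphB/= map_polyX map_polyC/= rmorphXn rmorph_prod.
Qed.

Lemma subset_poly_perm (A : comNzRingType) n (v : 'I_n -> A) (s : {perm 'I_n}) :
  subset_poly (v \o s) = subset_poly v.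
Proof.
rewrite /subset_poly [RHS](reindex (fun I : {set 'I_n} => s @: I))/=.
  apply: eq_bigr => I _; congr ('X - (_ ^+ 2)%:P).
  by rewrite big_imset//= => x y _ _; exact: perm_inj.
exists (fun I : {set 'I_n} => (s^-1)%g @: I) => I _; rewrite -imset_comp.
  by rewrite (eq_imset _ (permK s)) imset_id.
by rewrite (eq_imset _ (permKV s)) imset_id.
Qed.

Lemma ratfun_map_coef n (W : {poly mpoly n C}) :
  (forall s : {perm 'I_n}, map_poly (msym s) W = W) ->
  exists2 f : nat -> n.+1.-tuple R -> R, forall k, ratfun (f k) &
    forall (a : n.+1.-tuple R) (al : n.-tuple C),
      lcoef a != 0 -> root_tuple a al ->
      forall k, complex.Re (map_poly (meval (tnth al)) W)`_k = f k a.
Proof.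
move=> sW; pose P k (f : n.+1.-tuple R -> R) := ratfun f /\
    forall (a : n.+1.-tuple R) (al : n.-tuple C),
      lcoef a != 0 -> root_tuple a al ->
      complex.Re (meval (tnth al) W`_k) = f a.
have /choice[f fP] : forall k, exists f, P k f.
  by move=> k; have [f rf fE] := ratfun_sym (coef_symmetric sW k); exists f.
exists f => [k|a al a0 aal k]; first by have [] := fP k.
by rewrite coef_map/=; have [_] := fP k; exact.
Qed.

(** The polynomial is formed over the indeterminates, where it is permutation invariant, and then
    evaluated at the roots. *)
Lemma ratfun_sqdiff n : exists2 f : nat -> n.+1.-tuple R -> R, forall k, ratfun (f k) &
  forall (a : n.+1.-tuple R) (al : n.-tuple C), lcoef a != 0 -> root_tuple a al ->
  forall k, complex.Re (sqdiff_poly (tnth al))`_k = f k a.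
Proof.
have [|f rf fE] := @ratfun_map_coef n (sqdiff_poly (fun i => Xi i)).
  move=> s; rewrite map_sqdiff_poly -[RHS](sqdiff_poly_perm _ s); congr sqdiff_poly.
  by apply/funext => i; exact: msymXU.
exists f => // a al a0 aal k; rewrite -(fE a al a0 aal k) map_sqdiff_poly.
by congr (complex.Re (sqdiff_poly _)`_k); apply/funext => i /=; rewrite mevalXU.
Qed.

Lemma ratfun_subset n : exists2 f : nat -> n.+1.-tuple R -> R, forall k, ratfun (f k) &
  forall (a : n.+1.-tuple R) (al : n.-tuple C), lcoef a != 0 -> root_tuple a al ->
  forall k, complex.Re (subset_poly (tnth al))`_k = f k a.
Proof.
have [|f rf fE] := @ratfun_map_coef n (subset_poly (fun i => Xi i)).
  move=> s; rewrite map_subset_poly -[RHS](subset_poly_perm _ s); congr subset_poly.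
  by apply/funext => i; exact: msymXU.
exists f => // a al a0 aal k; rewrite -(fE a al a0 aal k) map_subset_poly.
by congr (complex.Re (subset_poly _)`_k); apply/funext => i /=; rewrite mevalXU.
Qed.

End Symmetric.

(** * The discriminant product, and sign conditions on coefficients *)

Section Criteria.
Context {R : realType}.
Local Notation C := R[i].
Local Notation RC := (real_complex R).

(** Up to sign, the product of the squared differences over i < j, that is, the discriminant without
    its power of the leading coefficient; ordered pairs make the symmetry evident. *)
Definition diff_prod (A : comNzRingType) n (v : 'I_n -> A) : A :=
  \prod_(i < n) \prod_(j < n | j != i) (v i - v j).

Lemma rmorph_diff_prod (A B : comNzRingType) (f : {rmorphism A -> B}) n (v : 'I_n -> A) :
  f (diff_prod v) = diff_prod (f \o v).
Proof.
rewrite /diff_prod rmorph_prod; apply: eq_bigr => i _; rewrite rmorph_prod.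
by apply: eq_bigr => j _; rewrite rmorphB.
Qed.

Lemma diff_prod_perm (A : comNzRingType) n (v : 'I_n -> A) (s : {perm 'I_n}) :
  diff_prod (v \o s) = diff_prod v.
Proof.
rewrite /diff_prod [RHS](reindex_perm s)/=; apply: eq_bigr => i _.
rewrite [RHS](reindex_perm s)/=; apply: eq_bigl => j.
by rewrite (inj_eq perm_inj).
Qed.

Lemma ratfun_diff_prod n : exists2 f : n.+1.-tuple R -> R, ratfun f &
  forall (a : n.+1.-tuple R) (al : n.-tuple C), lcoef a != 0 -> root_tuple a al ->
  complex.Re (diff_prod (tnth al)) = f a.
Proof.
pose Xi i := mpolyX C (mnm1 i) : mpoly n C.
have [|f rf fE] := @ratfun_sym _ n (diff_prod Xi).
  apply/issymP => s; rewrite rmorph_diff_prod -[RHS](diff_prod_perm _ s).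
  by congr diff_prod; apply/funext => i; exact: msymXU.
exists f => // a al a0 aal; rewrite -(fE a al a0 aal) rmorph_diff_prod.
by congr (complex.Re (diff_prod _)); apply/funext => i /=; rewrite mevalXU.
Qed.

Lemma coef_prod_XaddC_ge0 (K : numDomainType) (I : finType) (u : I -> K) :
  (forall i, 0 <= u i) -> forall k, 0 <= (\prod_i ('X + (u i)%:P))`_k.
Proof.
move=> u0; apply: (big_ind (fun p : {poly K} => forall k, 0 <= p`_k)).
- by move=> k; rewrite coef1 ler0n.
- move=> p q p0 q0 k; rewrite coefM; apply: sumr_ge0 => i _.
  exact: mulr_ge0.
- by move=> i _ k; rewrite coefD coefX coefC addr_ge0 ?ler0n//; case: ifP.
Qed.

Lemma Re_mulRC (z : C) (x : R) : complex.Re (z * RC x) = complex.Re z * x.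
Proof. by case: z => u v /=; rewrite mulr0 subr0. Qed.

(** At a real [x > 0] the real part of the value is a sum of nonnegative terms, of which the leading
    one is positive. *)
Lemma monic_coef_ge0_horner_neq0 (p : {poly C}) (x : R) : p \is monic ->
  (forall k, 0 <= complex.Re p`_k) -> 0 < x -> p.[RC x] != 0.
Proof.
move=> mp p0 x0; apply/negP => /eqP/(congr1 (@complex.Re R)).
rewrite horner_coef raddf_sum/= => E.
have pn0 : p != 0 by exact: monic_neq0.
have sp : ((size p).-1 < size p)%N by rewrite ltn_predL size_poly_gt0.
suff : 0 < \sum_(i < size p) complex.Re (p`_i * RC x ^+ i) by rewrite E ltxx.
rewrite (bigD1 (Ordinal sp))//=.
apply: ltr_wpDr.
  by apply: sumr_ge0 => i _; rewrite -rmorphXn Re_mulRC mulr_ge0// exprn_ge0// ltW.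
rewrite -rmorphXn Re_mulRC -/(lead_coef p) (monicP mp)/= mul1r.
exact: exprn_gt0.
Qed.

(** After the shift the factors are X + (z - y_i). Constants z - y_i >= 0 give nonnegative
    coefficients, while y_i > z would give the positive root y_i - z, which such coefficients
    exclude. *)
Lemma coef_shift_ge0P (I : finType) (y : I -> R) (z : R) :
  (forall i, y i <= z) <->
  (forall k, 0 <= (\prod_i ('X - (y i)%:P) \Po ('X + z%:P))`_k).
Proof.
have -> : \prod_i ('X - (y i)%:P) \Po ('X + z%:P) = \prod_i ('X + (z - y i)%:P).
  rewrite rmorph_prod; apply: eq_bigr => i _.
  by rewrite rmorphB/= comp_polyX comp_polyC polyCB addrA.
split=> [yz|cz i].
  by apply: coef_prod_XaddC_ge0 => i; rewrite subr_ge0.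
rewrite leNgt; apply/negP => zy.
pose p : {poly R} := \prod_i ('X + (z - y i)%:P).
have : (map_poly RC p).[RC (y i - z)] != 0.
  apply: monic_coef_ge0_horner_neq0; last by rewrite subr_gt0.
  - rewrite map_monic; apply: monic_prod => j _.
    by rewrite -[_%:P]opprK -polyCN monicXsubC.
  - by move=> k; rewrite coef_map/=; exact: cz.
rewrite horner_map fmorph_eq0 horner_prod (bigD1 i)//= hornerD hornerX hornerC.
by rewrite addrA subrK subrr mul0r eqxx.
Qed.

(** Taylor coefficients at a point which is itself rational in [a]; the powers of X + z are expanded
    by induction on the exponent. *)
Lemma ratfun_coef_comp n N (f : nat -> n.+1.-tuple R -> R) (z : n.+1.-tuple R -> R) k :
  (forall j, ratfun (f j)) -> ratfun z ->
  ratfun (fun a => (\poly_(j < N) f j a \Po ('X + (z a)%:P))`_k).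
Proof.
move=> rf rz.
have -> : (fun a => (\poly_(j < N) f j a \Po ('X + (z a)%:P))`_k) =
    (fun a => \sum_(j <- index_enum 'I_N) f j a * (('X + (z a)%:P) ^+ j)`_k).
  apply/funext => a; rewrite poly_def raddf_sum/= coef_sum; apply: eq_bigr => j _.
  by rewrite comp_polyZ comp_Xn_poly coefZ.
apply: ratfun_sum => j; apply: ratfunM; first exact: rf.
elim: (nat_of_ord j) k => [|i IH] k.
  have -> : (fun a => (('X + (z a)%:P) ^+ 0)`_k) = (fun=> (k == 0)%:R).
    by apply/funext => a; rewrite expr0 coef1.
  exact: ratfun_cst.
have -> : (fun a => (('X + (z a)%:P) ^+ i.+1)`_k) =
    (fun a => (if k is k'.+1 then (('X + (z a)%:P) ^+ i)`_k' else 0) +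
              z a * (('X + (z a)%:P) ^+ i)`_k).
  by apply/funext => a; rewrite exprS mulrDl coefD coefXM coefCM; case: k.
apply: ratfunD; last exact: ratfunM.
by case: k => [|k]; [exact: ratfun_cst|exact: IH].
Qed.

End Criteria.

(** * The region of coefficient vectors *)

Section Region.
Context {R : realType}.
Local Notation C := R[i].
Local Notation RC := (real_complex R).
Local Notation point d := (d.-tuple (measurableTypeR R)).

Lemma size_Poly_tuple n (a : n.+1.-tuple R) : lcoef a != 0 -> size (Poly a) = n.+1.
Proof.
move=> a0; rewrite (@PolyK _ 0) ?size_tuple//.
rewrite (last_nth 0) size_tuple/=; move: a0; rewrite /lcoef (tnth_nth 0)/=.
by case: a => -[|x s].
Qed.

Lemma lead_coef_Poly_tuple n (a : n.+1.-tuple R) :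
  lcoef a != 0 -> lead_coef (Poly a) = lcoef a.
Proof.
by move=> a0; rewrite /lead_coef size_Poly_tuple// coef_Poly /lcoef (tnth_nth 0).
Qed.

Lemma croots_tuple n (a : n.+1.-tuple R) : lcoef a != 0 ->
  exists2 al : n.-tuple C, croots (Poly a) = al & root_tuple a al.
Proof.
move=> a0; have P0 : Poly a != 0 by rewrite -size_poly_eq0 size_Poly_tuple.
have [+ /eqP] := crootsP P0; rewrite lead_coef_Poly_tuple// size_Poly_tuple// => E sz.
by exists (Tuple sz).
Qed.

Lemma complex_eqE (z : C) : complex.Im z = 0 -> z = RC (complex.Re z).
Proof. by case: z => x y /= ->. Qed.

Lemma root_tupleE n (a : n.+1.-tuple R) (al : n.-tuple C) : lcoef a != 0 ->
  root_tuple a al -> forall z, root (complex_poly (Poly a)) z = (z \in al).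
Proof.
by move=> a0 -> z; rewrite rootZ ?fmorph_eq0// root_prod_XsubC.
Qed.

Lemma root_complex_poly_conj (P : {poly R}) z :
  root (complex_poly P) z -> root (complex_poly P) (conjc z).
Proof.
rewrite /root => /eqP Pz; have -> : complex_poly P = map_poly conjc (complex_poly P).
  by apply/polyP => k; rewrite !coef_map/= oppr0.
by rewrite horner_map Pz rmorph0.
Qed.

Lemma real_rooted_tuple n (a : n.+1.-tuple R) (al : n.-tuple C) :
  lcoef a != 0 -> root_tuple a al -> real_rooted (Poly a) ->
  exists x : 'I_n -> R, tnth al = RC \o x.
Proof.
move=> a0 aal rr; exists (fun i => complex.Re (tnth al i)).
apply/funext => i /=; apply: complex_eqE; apply: rr.
by rewrite (root_tupleE a0 aal) mem_tnth.
Qed.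

Lemma sqdiff_poly_monic (A : comNzRingType) n (v : 'I_n -> A) : sqdiff_poly v \is monic.
Proof.
apply: monic_prod => i _; apply: monic_prod => j _; exact: monicXaddC.
Qed.

(* If [z] is a nonreal root, so is its conjugate, and [sqdiff_poly] then has the
   positive root [4 * (Im z) ^ 2], which nonnegative coefficients exclude. *)
Lemma real_rootedP n (a : n.+1.-tuple R) (al : n.-tuple C) :
  lcoef a != 0 -> root_tuple a al ->
  real_rooted (Poly a) <-> (forall k, 0 <= complex.Re (sqdiff_poly (tnth al))`_k).
Proof.
move=> a0 aal; split=> [rr k|W0 z rz].
  have [x ->] := real_rooted_tuple a0 aal rr.
  rewrite -map_sqdiff_poly coef_map/= /sqdiff_poly pair_bigA/=.
  apply: (@coef_prod_XaddC_ge0 R _ (fun p : 'I_n * 'I_n => (x p.1 - x p.2) ^+ 2)) => p.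
  exact: sqr_ge0.
apply/eqP/negP => /negP Iz.
have := rz; rewrite (root_tupleE a0 aal) => /tnthP[i zi].
have := root_complex_poly_conj rz; rewrite (root_tupleE a0 aal) => /tnthP[j zj].
have y0 : 0 < 4 * complex.Im z ^+ 2 by rewrite mulr_gt0// exprn_even_gt0.
have := monic_coef_ge0_horner_neq0 (sqdiff_poly_monic _) W0 y0.
rewrite /sqdiff_poly horner_prod (bigD1 i)//= horner_prod (bigD1 j)//=.
rewrite hornerD hornerX hornerC -zi -zj.
suff -> : RC (4 * complex.Im z ^+ 2) + (z - conjc z) ^+ 2 = 0 by rewrite !mul0r eqxx.
case: z {zi zj rz Iz y0} => u v /=; rewrite expr2; simpc.
by apply/eqP; rewrite eq_complex/=; apply/andP; split; apply/eqP; ring.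
Qed.

Lemma normc_prod (I : Type) (r : seq I) (P : pred I) (F : I -> C) :
  Normc.normc (\prod_(i <- r | P i) F i) = \prod_(i <- r | P i) Normc.normc (F i).
Proof.
apply: (big_morph (@Normc.normc R) (id1 := 1) (op1 := *%R)).
  exact: Normc.normcM.
by rewrite /Normc.normc /= expr1n expr0n addr0 sqrtr1.
Qed.

Lemma normcRC (x : R) : Normc.normc (RC x) = `|x|.
Proof. by rewrite /Normc.normc/= expr0n addr0 sqrtr_sqr. Qed.

(** The factors for (i, j) and (j, i) have equal modulus, so the ordered pairs produce the
    squares. *)
Lemma normc_diff_prod n (v : 'I_n -> C) :
  Normc.normc (\prod_(i < n) \prod_(j < n | (i < j)%N) (v i - v j) ^+ 2) =
  Normc.normc (diff_prod v).
Proof.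
pose w i j := Normc.normc (v i - v j).
have wC i j : w i j = w j i by rewrite /w -opprB;
  case: (v j - v i) => p q; rewrite /Normc.normc/= !sqrrN.
rewrite /diff_prod !normc_prod.
under eq_bigr do rewrite normc_prod; under [RHS]eq_bigr do rewrite normc_prod.
have -> : \prod_(i < n) \prod_(j < n | j != i) w i j =
    (\prod_(i < n) \prod_(j < n | (i < j)%N) w i j) *
    (\prod_(i < n) \prod_(j < n | (j < i)%N) w i j).
  rewrite -big_split/=; apply: eq_bigr => i _.
  rewrite (bigID (fun j : 'I_n => (i < j)%N))/=; congr (_ * _).
    by apply: eq_bigl => j; rewrite -val_eqE/= andbC; case: ltngtP.
  by apply: eq_bigl => j; rewrite -val_eqE/= andbC; case: ltngtP.
have -> : \prod_(i < n) \prod_(j < n | (j < i)%N) w i j =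
    \prod_(i < n) \prod_(j < n | (i < j)%N) w i j.
  rewrite (exchange_big_dep predT)//=; apply: eq_bigr => i _.
  by apply: eq_bigr => j _; exact: wC.
rewrite -big_split/=; apply: eq_bigr => i _; rewrite -big_split/=; apply: eq_bigr => j _.
by rewrite expr2 Normc.normcM.
Qed.

Lemma abs_discriminantE n (a : n.+1.-tuple R) (al : n.-tuple C) :
  lcoef a != 0 -> croots (Poly a) = al ->
  abs_discriminant (Poly a) =
    `|lcoef a| ^+ (2 * n - 2) * Normc.normc (diff_prod (tnth al)).
Proof.
move=> a0 E; rewrite /abs_discriminant /discriminant E size_Poly_tuple//=.
rewrite lead_coef_Poly_tuple// Normc.normcM -rmorphXn normcRC normrX; congr (_ * _).
rewrite -normc_diff_prod; congr Normc.normc.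
by apply: eq_bigr => i _; apply: eq_bigr => j _; rewrite !(tnth_nth 0).
Qed.

(** Real roots make [diff_prod] real, so that its modulus can be read off from its real part, the
    quantity known to be rational in [a]. *)
Lemma abs_discriminant_real n (a : n.+1.-tuple R) (al : n.-tuple C) :
  lcoef a != 0 -> croots (Poly a) = al -> root_tuple a al ->
  real_rooted (Poly a) -> abs_discriminant (Poly a) =
    `|lcoef a ^+ (2 * n - 2) * complex.Re (diff_prod (tnth al))|.
Proof.
move=> a0 E aal rr; rewrite (abs_discriminantE a0 E) normrM normrX; congr (_ * _).
have [x ->] := real_rooted_tuple a0 aal rr.
by rewrite -rmorph_diff_prod normcRC.
Qed.

End Region.

(** * Tameness of the region, uniform in the discriminant bound *)

Section RegionTame.
Context {R : realType}.
Local Notation C := R[i].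
Local Notation RC := (real_complex R).
Local Notation point d := (d.-tuple (measurableTypeR R)).

Definition utame d (A : R -> set (point d)) := exists k, forall c, tame k (A c).

Lemma tameW d k1 k2 (A : set (point d)) : (k1 <= k2)%N -> tame k1 A -> tame k2 A.
Proof.
move=> k12 [mA tA]; split=> // a i; have [s sk c] := tA a i.
by exists s => //; exact: leq_trans k12.
Qed.

Lemma utameI d (A1 A2 : R -> set (point d)) :
  utame A1 -> utame A2 -> utame (fun c => A1 c `&` A2 c).
Proof.
by move=> [k1 t1] [k2 t2]; exists (k1 + k2)%N => c; exact: tameI.
Qed.

Lemma utame_forall d (I : finType) (A : I -> R -> set (point d)) :
  (forall i, utame (A i)) -> utame (fun c => [set a | forall i, A i c a]).
Proof.
move=> /choice[k tA]; exists (#|I| * \max_i k i)%N => c.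
by apply: tame_bigcap => i; apply: tameW (tA i c); exact: leq_bigmax.
Qed.

Lemma utame_le n (f : n.+1.-tuple R -> R) : ratfun f ->
  utame (fun c => [set a : point n.+1 | lcoef (a : n.+1.-tuple R) != 0 /\ f a <= c]).
Proof. exact: ratfun_le. Qed.

Lemma utame_le_cst n (f : n.+1.-tuple R -> R) b : ratfun f ->
  utame (fun=> [set a : point n.+1 | lcoef (a : n.+1.-tuple R) != 0 /\ f a <= b]).
Proof. by move=> /ratfun_le[k tk]; exists k => _; exact: tk. Qed.

Lemma ratfunN n (f : n.+1.-tuple R -> R) : ratfun f -> ratfun (fun a => - f a).
Proof.
move=> rf; have -> : (fun a => - f a) = (fun a => -1 * f a).
  by apply/funext => a; rewrite mulN1r.
by apply: ratfunM => //; exact: ratfun_cst.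
Qed.

Lemma ratfun_tnth n (i : 'I_n.+1) : ratfun (fun a : n.+1.-tuple R => tnth a i).
Proof. exact/polyfun_ratfun/polyfun_tnth. Qed.

(** Taking real-rootedness for [D] permits descriptions of the discriminant and the Mahler measure
    that are correct for real roots only. *)
Definition definable n (D : n.+1.-tuple R -> Prop) (P : R -> n.+1.-tuple R -> Prop) :=
  exists2 A : R -> set (point n.+1), utame A &
    forall c (a : n.+1.-tuple R), lcoef a != 0 -> D a -> A c a <-> P c a.

Lemma coef_ge0_bounded (p : {poly R}) N : (size p <= N)%N ->
  (forall k, 0 <= p`_k) <-> (forall k : 'I_N, 0 <= p`_k).
Proof.
move=> sp; split=> [p0 k|p0 k]; first exact: p0.
have [kN|Nk] := ltnP k N; first exact: p0 (Ordinal kN).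
by rewrite nth_default// (leq_trans sp).
Qed.

Lemma definable_real_rooted n :
  @definable n (fun=> True) (fun _ a => real_rooted (Poly a)).
Proof.
have [f rf fE] := @ratfun_sqdiff R n.
(* One linear factor per ordered pair gives degree n^2, so these coefficients are all of them. *)
exists (fun _ => [set a : point n.+1 | forall k : 'I_(n * n).+1,
    lcoef (a : n.+1.-tuple R) != 0 /\ - f k a <= 0]).
  by apply: utame_forall => k; apply: utame_le_cst; exact: ratfunN.
move=> _ a a0 _; have [al _ aal] := croots_tuple a0.
apply: iff_trans (iff_sym (real_rootedP a0 aal)).
have sz : (size (sqdiff_poly (tnth al)) <= (n * n).+1)%N.
  rewrite /sqdiff_poly pair_bigA/=.
  rewrite (eq_bigr (fun p : 'I_n * 'I_n => 'X - (- (tnth al p.1 - tnth al p.2) ^+ 2)%:P)).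
    by rewrite size_prod_XsubC ltnS /index_enum -enumT -cardE card_prod card_ord.
  by move=> p _; rewrite polyCN opprK.
split=> [h k|h k]; last by split=> //; rewrite oppr_le0 -(fE a al a0 aal).
have [kN|Nk] := ltnP k (n * n).+1.
  by have [_] := h (Ordinal kN); rewrite oppr_le0 (fE a al a0 aal).
by rewrite nth_default// (leq_trans sz).
Qed.

Lemma definable_discriminant n : definable
  (fun a : n.+1.-tuple R => real_rooted (Poly a))
  (fun c a => abs_discriminant (Poly a) <= c).
Proof.
have [f rf fE] := @ratfun_diff_prod R n.
pose g (a : n.+1.-tuple R) := lcoef a ^+ (2 * n - 2) * f a.
have rg : ratfun g by apply: ratfunM => //; apply: ratfunX; exact: ratfun_tnth.
exists (fun c => [set a : point n.+1 | lcoef (a : n.+1.-tuple R) != 0 /\ g a <= c] `&`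
    [set a : point n.+1 | lcoef (a : n.+1.-tuple R) != 0 /\ - g a <= c]).
  by apply: utameI; apply: utame_le => //; exact: ratfunN.
move=> c a a0 rr; have [al aE aal] := croots_tuple a0.
rewrite (abs_discriminant_real a0 aE aal rr) (fE a al a0 aal) -/(g a).
rewrite ler_norml lerNl; split; first by move=> [[_ ->] [_ ->]].
by move=> /andP[? ?]; split.
Qed.

Lemma definable_naive n : definable (fun a : n.+1.-tuple R => real_rooted (Poly a))
  (fun _ a => naive_height (Poly a) <= 1).
Proof.
exists (fun _ => [set a : point n.+1 | forall k : 'I_n.+1,
    lcoef (a : n.+1.-tuple R) != 0 /\ tnth (a : n.+1.-tuple R) k ^+ 2 <= 1]).
  by apply: utame_forall => k; apply: utame_le_cst; apply: ratfunX; exact: ratfun_tnth.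
move=> _ a a0 _; rewrite /naive_height size_Poly_tuple//.
have sq (k : 'I_n.+1) : (tnth a k ^+ 2 <= 1) = (`|(Poly a)`_k| <= 1).
  by rewrite coef_Poly -(tnth_nth 0) -real_normK ?num_real// expr_le1.
split=> [h|/bigmax_leP[_ h] k]; last by rewrite sq; split=> //; exact: h.
by apply/bigmax_leP; split=> // k _; have [_] := h k; rewrite sq.
Qed.

(** The sum of absolute values is the largest of the 2^(n+1) signed sums, attained when the signs
    are those of the coefficients. *)
Lemma definable_length n : definable (fun a : n.+1.-tuple R => real_rooted (Poly a))
  (fun _ a => poly_length (Poly a) <= 1).
Proof.
pose sg (S : {set 'I_n.+1}) (k : 'I_n.+1) : R := if k \in S then 1 else -1.
exists (fun _ => [set a : point n.+1 | forall S : {set 'I_n.+1},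
    lcoef (a : n.+1.-tuple R) != 0 /\
    \sum_(k <- index_enum 'I_n.+1) sg S k * tnth (a : n.+1.-tuple R) k <= 1]).
  apply: utame_forall => S; apply: utame_le_cst; apply: ratfun_sum => k.
  by apply: ratfunM; [exact: ratfun_cst|exact: ratfun_tnth].
move=> _ a a0 _; rewrite /poly_length size_Poly_tuple//.
have -> : \sum_(k < n.+1) `|(Poly a)`_k| = \sum_(k < n.+1) `|tnth a k|.
  by apply: eq_bigr => k _; rewrite coef_Poly -(tnth_nth 0).
split=> [h|h S].
  have [_] := h [set k | 0 <= tnth a k]%SET; congr (_ <= _); apply: eq_bigr => k _.
  rewrite /sg inE; case: ifPn => [k0|]; first by rewrite mul1r ger0_norm.
  by rewrite -ltNge mulN1r => k0; rewrite ltr0_norm.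
split=> //; apply: le_trans h; apply: ler_sum => k _.
by rewrite /sg; case: ifP => _; rewrite ?mul1r ?mulN1r ?ler_norm// -normrN ler_norm.
Qed.

(** The product of the maxima is the largest subset product, attained when [S] collects the y_i >
    1. *)
Lemma prod_max1_leP n (y : 'I_n -> R) (b : R) : 0 <= b -> (forall i, 0 <= y i) ->
  b * \prod_(i < n) Num.max 1 (y i) <= 1 <->
  (forall S : {set 'I_n}, b * \prod_(i in S) y i <= 1).
Proof.
move=> b0 y0; split=> [h S|h].
  apply: le_trans h; apply: ler_wpM2l => //; rewrite big_mkcond/=.
  by apply: ler_prod => i _; case: ifP => _; rewrite ?y0 ?ler01 le_max lexx ?orbT.
have := h [set i | 1 < y i]%SET; congr (_ * _ <= _); rewrite big_mkcond/=.
by apply: eq_bigr => i _; rewrite inE; case: ltP.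
Qed.

(* For real roots [x_i], the Mahler measure is at most 1 iff no subset product
   satisfies [(prod_(i in S) x_i) ^ 2 > a_n ^ -2], that is, iff the polynomial with
   roots [(prod_(i in S) x_i) ^ 2] has nonnegative Taylor coefficients at [a_n ^ -2]. *)
Lemma definable_mahler n : definable (fun a : n.+1.-tuple R => real_rooted (Poly a))
  (fun _ a => mahler_measure (Poly a) <= 1).
Proof.
have [f rf fE] := @ratfun_subset R n.
(* There are 2^n subsets, each giving a linear factor, so [N] is the size of [subset_poly]. *)
pose N := (size (index_enum {set 'I_n})).+1.
pose z (a : n.+1.-tuple R) := (1 / lcoef a) ^+ 2.
have rz : ratfun z.
  apply: ratfunX; exists 1%N, 1%N, (fun=> 1); split; first exact: polyfun_cst.
  by move=> a a0; rewrite expr1 mul1r divff.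
pose g (k : nat) (a : n.+1.-tuple R) := (\poly_(j < N) f j a \Po ('X + (z a)%:P))`_k.
exists (fun _ => [set a : point n.+1 | forall k : 'I_N,
    lcoef (a : n.+1.-tuple R) != 0 /\ - g k a <= 0]).
  apply: utame_forall => k; apply: utame_le_cst; apply: ratfunN.
  exact: ratfun_coef_comp.
move=> _ a a0 rr; have [al aE aal] := croots_tuple a0.
have [x xE] := real_rooted_tuple a0 aal rr.
pose p := \prod_(I : {set 'I_n}) ('X - ((\prod_(i in I) x i) ^+ 2)%:P) : {poly R}.
have pE : \poly_(j < N) f j a = p.
  have sp : size p = N by rewrite size_prod_XsubC.
  apply/polyP => j; rewrite coef_poly -sp; case: ltnP => [_|];
    last by move=> ?; rewrite nth_default.
  by rewrite -(fE a al a0 aal) xE -map_subset_poly coef_map.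
have sg : (size (p \Po ('X + (z a)%:P)) <= N)%N.
  by rewrite size_comp_poly2 ?size_XaddC// size_prod_XsubC.
apply: (@iff_trans _ (forall k : 'I_N, 0 <= (p \Po ('X + (z a)%:P))`_k)).
  split=> h k; first by have [_] := h k; rewrite /g pE oppr_le0.
  by split=> //; rewrite /g pE oppr_le0.
apply: iff_trans (iff_sym (coef_ge0_bounded sg)) _.
apply: iff_trans (iff_sym (coef_shift_ge0P _ _)) _.
rewrite /mahler_measure lead_coef_Poly_tuple// aE.
have -> : \prod_(w <- al) Num.max 1 (Normc.normc w) = \prod_(i < n) Num.max 1 `|x i|.
  by rewrite big_tuple; apply: eq_bigr => i _; rewrite xE normcRC.
apply: iff_trans (iff_sym (prod_max1_leP _ _)) => //.
have la0 : 0 < `|lcoef a| by rewrite normr_gt0.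
have H S : ((\prod_(i in S) x i) ^+ 2 <= z a) = (`|lcoef a| * \prod_(i in S) `|x i| <= 1).
  rewrite -normr_prod /z div1r -[X in X <= _]real_normK ?num_real//.
  rewrite -[X in _ <= X]real_normK ?num_real// ler_sqr ?nnegrE//.
  by rewrite normfV mulrC -ler_pdivlMr// mul1r.
by split=> h S; [rewrite -H|rewrite H].
Qed.

Lemma definable_height n (h : height_kind) :
  definable (fun a : n.+1.-tuple R => real_rooted (Poly a))
  (fun _ a => height h (Poly a) <= 1).
Proof.
case: h; [exact: definable_naive|exact: definable_mahler|exact: definable_length].
Qed.

Lemma utame_coef_region n (h : height_kind) :
  utame (fun delta => @coef_region R n h delta).
Proof.
have [A1 tA1 A1E] := definable_real_rooted n.
have [A2 tA2 A2E] := definable_height n h.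
have [A3 tA3 A3E] := definable_discriminant n.
(* The trivial inequality brings the condition on the leading coefficient into the form handled by
   [utame_le_cst]. *)
have t0 : utame (fun=> [set a : point n.+1 | lcoef (a : n.+1.-tuple R) != 0 /\ 0 <= 0 :> R]).
  exact: utame_le_cst (ratfun_cst _ _).
have [k tk] := utameI t0 (utameI tA1 (utameI tA2 tA3)).
exists k => c; have := tk c; congr tame; apply/seteqP; split=> a /=.
  move=> [[a0 _] [/(A1E _ _ a0 Logic.I) rr [/(A2E _ _ a0 rr) ha /(A3E _ _ a0 rr) da]]].
  by split.
move=> [a0 rr ha da]; split=> //; split; first exact/A1E.
by split; [exact/A2E|exact/A3E].
Qed.

End RegionTame.

(** * Homogeneity and the lattice points *)

Section Scaling.
Context {R : realType}.
Local Notation C := R[i].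
Local Notation RC := (real_complex R).
Local Notation point d := (d.-tuple (measurableTypeR R)).

(** Each factor X - z multiplies the bound by at most 1 + |z|, hence by at most 2 max(1, |z|). *)
Lemma coef_prod_XsubC_bound (r : seq C) k :
  Normc.normc (\prod_(z <- r) ('X - z%:P))`_k <=
  2 ^+ size r * \prod_(z <- r) Num.max 1 (Normc.normc z).
Proof.
suff H : forall k, (`|(\prod_(z <- r) ('X - z%:P))`_k| <=
    RC (2 ^+ size r * \prod_(z <- r) Num.max 1 (Normc.normc z))).
  by rewrite -lecR; exact: H.
elim: r {k} => [|z r IH] k.
  rewrite !big_nil mulr1 coef1 expr0; case: (k == 0%N); rewrite ?normr1 ?normr0 ?ler01//.
rewrite !big_cons /= exprS.
set m := Num.max 1 _; set b := 2 ^+ size r * _ in IH.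
have -> : 2 * 2 ^+ size r * (m * \prod_(z <- r) Num.max 1 (Normc.normc z)) = m * b + m * b.
  by rewrite /b; ring.
have b0 : 0 <= b by rewrite -lecR; apply: le_trans (IH 0%N); exact: normr_ge0.
have m1 : 1 <= m by rewrite le_max lexx.
have mz : `|z| <= RC m.
  by rewrite -[X in X <= _]/(RC (Normc.normc z)) lecR le_max lexx orbT.
rewrite mulrBl coefB coefXM coefCM (le_trans (ler_normB _ _))//.
rewrite (rmorphD RC (m * b) (m * b)); apply: lerD.
  case: eqP => _; first by rewrite normr0 lecR mulr_ge0// (le_trans ler01).
  by apply: le_trans (IH _) _; rewrite lecR ler_peMl.
by rewrite normrM (rmorphM RC m b); apply: ler_pM.
Qed.

Lemma coef_le_mahler n (a : n.+1.-tuple R) (i : 'I_n.+1) : lcoef a != 0 ->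
  `|tnth a i| <= 2 ^+ n * mahler_measure (Poly a).
Proof.
move=> a0; have [al aE aal] := croots_tuple a0.
rewrite /mahler_measure lead_coef_Poly_tuple// aE mulrCA.
have -> : `|tnth a i| = Normc.normc (complex_poly (Poly a))`_i.
  by rewrite coef_map normcRC coef_Poly (tnth_nth 0).
rewrite aal coefZ Normc.normcM normcRC ler_wpM2l//.
by have := coef_prod_XsubC_bound al i; rewrite size_tuple.
Qed.

(** The factor [2 ^+ n] is the cost of the Mahler measure; for the other two heights the
    coefficients are at most 1. *)
Lemma coef_region_bounded n (h : height_kind) delta (a : n.+1.-tuple R) i :
  @coef_region R n h delta a -> `|tnth a i| <= 2 ^+ n.
Proof.
move=> [a0 _ + _]; have e1 : 1 <= 2 ^+ n :> R by rewrite exprn_ege1// ler1n.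
have ai : `|tnth a i| = `|(Poly a)`_i| by rewrite coef_Poly (tnth_nth 0).
case: h => /=.
- rewrite /naive_height size_Poly_tuple// => /bigmax_leP[_ h].
  by rewrite ai (le_trans (h i isT)).
- move=> h; rewrite (le_trans (coef_le_mahler _ a0))//.
  by rewrite -[leRHS]mulr1 ler_wpM2l// exprn_ge0.
- rewrite /poly_length size_Poly_tuple// => h; rewrite ai (le_trans _ e1)//.
  apply: le_trans h; rewrite (bigD1 i)//= lerDl.
  by apply: sumr_ge0 => j _.
Qed.

Section Scale.
Variables (n : nat) (Q : R) (a b : n.+1.-tuple R).
Hypotheses (Q0 : 0 < Q) (bE : forall i, tnth b i = Q * tnth a i).

Lemma lcoef_scale : (lcoef b != 0) = (lcoef a != 0).
Proof. by rewrite /lcoef bE mulf_eq0 negb_or gt_eqF. Qed.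

Lemma Poly_scale : Poly b = Q *: Poly a.
Proof.
apply/polyP => k; rewrite coefZ !coef_Poly.
have [kn|nk] := ltnP k n.+1; last by rewrite !nth_default ?size_tuple// mulr0.
by have := bE (Ordinal kn); rewrite !(tnth_nth 0).
Qed.

Lemma real_rooted_scale : real_rooted (Poly b) <-> real_rooted (Poly a).
Proof.
have E z : root (complex_poly (Poly b)) z = root (complex_poly (Poly a)) z.
  by rewrite Poly_scale /complex_poly map_polyZ rootZ// fmorph_eq0 gt_eqF.
by split=> h z; have := h z; rewrite E.
Qed.

Lemma root_tuple_scale (al : n.-tuple C) : root_tuple a al -> root_tuple b al.
Proof.
rewrite /root_tuple Poly_scale /complex_poly map_polyZ/= => ->.
by rewrite scalerA /lcoef bE rmorphM.
Qed.

Lemma root_tuple_perm (c : n.+1.-tuple R) (al be : n.-tuple C) : lcoef c != 0 ->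
  root_tuple c al -> root_tuple c be -> perm_eq al be.
Proof.
rewrite /root_tuple => c0 -> /scalerI E; apply/prod_XsubC_eq/E.
by rewrite fmorph_eq0.
Qed.

(** The lists [croots (Poly a)] and [croots (Poly b)] are chosen independently and agree only up to
    order, which [diff_prod] ignores. *)
Lemma abs_discriminant_scale : lcoef a != 0 ->
  abs_discriminant (Poly b) = Q ^+ (2 * n - 2) * abs_discriminant (Poly a).
Proof.
move=> a0; have b0 : lcoef b != 0 by rewrite lcoef_scale.
have [al aE aal] := croots_tuple a0; have [be beE bbe] := croots_tuple b0.
rewrite (abs_discriminantE a0 aE) (abs_discriminantE b0 beE).
have /tuple_permP[s sE] := root_tuple_perm b0 bbe (root_tuple_scale aal).
have -> : tnth be = tnth al \o s.
  apply/funext => i; rewrite (tnth_nth 0) sE /=.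
  by rewrite (nth_map i) ?size_enum_ord// nth_ord_enum.
by rewrite diff_prod_perm /lcoef bE normrM exprMn mulrA (gtr0_norm Q0).
Qed.

Lemma height_scale (h : height_kind) : lcoef a != 0 ->
  height h (Poly b) = Q * height h (Poly a).
Proof.
move=> a0; have b0 : lcoef b != 0 by rewrite lcoef_scale.
have E k : `|(Poly b)`_k| = Q * `|(Poly a)`_k|.
  by rewrite Poly_scale coefZ normrM (gtr0_norm Q0).
case: h => /=.
- rewrite /naive_height !size_Poly_tuple//; under eq_bigr do rewrite E.
  apply/esym/(big_morph (fun x => Q * x)); last exact: mulr0.
  by move=> x y /=; rewrite maxr_pMr// ltW.
- rewrite /mahler_measure !lead_coef_Poly_tuple//.
  have [al -> aal] := croots_tuple a0; have [be -> bbe] := croots_tuple b0.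
  rewrite (perm_big _ (root_tuple_perm b0 bbe (root_tuple_scale aal))).
  by rewrite /lcoef bE normrM mulrA (gtr0_norm Q0).
- rewrite /poly_length !size_Poly_tuple//; under eq_bigr do rewrite E.
  by rewrite mulr_sumr.
Qed.

End Scale.
End Scaling.

(** * Integer polynomials as lattice points *)

Section Counting.
Context {R : realType}.
Variables (n : nat) (h : height_kind) (Q v : R) (M : nat).
Hypotheses (n_gt0 : (0 < n)%N) (Q_gt0 : 0 < Q) (QM : Q * 2 ^+ n < M%:R).
Local Notation point d := (d.-tuple (measurableTypeR R)).
Local Notation cell := (n.+1.-tuple 'I_M.*2.+1).

Definition int_poly (c : cell) : {poly int} := Poly [seq (nat_of_ord i)%:Z - M%:Z | i <- c].

Definition int_point (c : cell) : n.+1.-tuple R :=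
  [tuple (tnth c j)%:R - M%:R | j < n.+1].

Lemma coef_int_poly c (k : 'I_n.+1) : (int_poly c)`_k = (tnth c k)%:Z - M%:Z.
Proof.
by rewrite coef_Poly (nth_map ord0) ?size_tuple// (tnth_nth ord0).
Qed.

Lemma map_int_poly c : map_poly intr (int_poly c) = Poly (int_point c) :> {poly R}.
Proof.
apply/polyP => k; rewrite coef_map/= [RHS]coef_Poly.
have [kn|nk] := ltnP k n.+1; last first.
  have -> : (int_point c)`_k = 0 by apply: nth_default; rewrite size_tuple.
  by rewrite coef_Poly nth_default 1?size_map 1?size_tuple.
have := coef_int_poly c (Ordinal kn) => /= ->.
by rewrite intrB -(tnth_nth 0 (int_point c) (Ordinal kn)) tnth_mktuple.
Qed.

Lemma int_poly_inj : injective int_poly.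
Proof.
move=> c1 c2 E; apply: eq_from_tnth => k; apply: val_inj.
have := congr1 (fun p : {poly int} => p`_k) E; rewrite !coef_int_poly.
by move=> /addIr[].
Qed.

Lemma int_point_scale c i : tnth (int_point c) i = Q * tnth (grid_point Q c) i.
Proof. by rewrite !tnth_mktuple /grid mulrC divfK// gt_eqF. Qed.

(** By homogeneity, dividing the coefficients by [Q] divides the height by [Q] and the discriminant
    by Q^(2n-2); what remains of the discriminant bound is Q^(-2v). *)
Lemma int_polys_region (p : {poly int}) (a b : n.+1.-tuple R) :
  map_poly intr p = Poly b -> (forall i, tnth b i = Q * tnth a i) ->
  int_polys n h Q v p <-> coef_region h (Q `^ (- (2 * v))) (a : point n.+1).
Proof.
move=> pb ab; rewrite /int_polys /coef_region/= pb.
have szE : size p = size (Poly b).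
  by rewrite -pb size_map_inj_poly// => x y /eqP; rewrite eqr_int => /eqP.
have a0E : size p = n.+1 <-> lcoef a != 0.
  rewrite szE -(lcoef_scale Q_gt0 ab); split; last exact: size_Poly_tuple.
  move=> sz; have := lead_coef_eq0 (Poly b).
  rewrite /lead_coef sz/= coef_Poly -(tnth_nth 0 _ ord_max) -size_poly_eq0 sz => h0.
  by rewrite /lcoef h0.
(* Here [0 < n] makes the truncated subtraction [2 * n - 2] agree with the real one. *)
have powE : Q `^ (2 * n%:R - 2 - 2 * v) = Q ^+ (2 * n - 2) * Q `^ (- (2 * v)).
  rewrite powRD; last by apply/implyP => _; rewrite gt_eqF.
  by rewrite -powR_mulrn ?ltW// natrB ?natrM// leq_pmulr.
have Qn : 0 < Q ^+ (2 * n - 2) by rewrite exprn_gt0.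
split.
  move=> [sz hQ dQ rr]; have a0 := a0E.1 sz; split=> //.
  - exact/(real_rooted_scale Q_gt0 ab).
  - by move: hQ; rewrite (height_scale Q_gt0 ab)// -[X in _ <= X]mulr1 ler_pM2l.
  - by move: dQ; rewrite (abs_discriminant_scale Q_gt0 ab)// powE ler_pM2l.
move=> [a0 rr hQ dQ]; split=> //.
- exact/a0E.
- by rewrite (height_scale Q_gt0 ab)// -[X in _ <= X]mulr1 ler_pM2l.
- by rewrite (abs_discriminant_scale Q_gt0 ab)// powE ler_pM2l.
- exact/(real_rooted_scale Q_gt0 ab).
Qed.

(** Coefficients of a counted polynomial are at most Q 2^n < M in absolute value, so the index
    vectors miss none of them. *)
Lemma int_polys_ex p : int_polys n h Q v p -> exists c, p = int_poly c.
Proof.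
move=> pP; have [sz _ _ _] := pP.
pose a : n.+1.-tuple R := [tuple (p`_j)%:~R / Q | j < n.+1].
pose b : n.+1.-tuple R := [tuple (p`_j)%:~R | j < n.+1].
have ab i : tnth b i = Q * tnth a i by rewrite !tnth_mktuple mulrC divfK// gt_eqF.
have pb : map_poly intr p = Poly b.
  apply/polyP => k; rewrite coef_map/= [RHS]coef_Poly.
  have [kn|nk] := ltnP k n.+1; last first.
    have -> : b`_k = 0 by apply: nth_default; rewrite size_tuple.
    by rewrite nth_default ?sz.
  by rewrite -(tnth_nth 0 b (Ordinal kn)) tnth_mktuple.
have pM (k : 'I_n.+1) : `|p`_k| < M%:Z.
  rewrite -(ltr_int R) intr_norm; apply: le_lt_trans QM.
  have -> : (p`_k)%:~R = Q * tnth a k by rewrite -ab tnth_mktuple.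
  rewrite normrM gtr0_norm// ler_pM2l//.
  exact: coef_region_bounded ((int_polys_region pb ab).1 pP).
pose c : cell := [tuple inord (absz (p`_j + M%:Z)) | j < n.+1].
exists c; apply/polyP => k.
have [kn|nk] := ltnP k n.+1; last first.
  rewrite (nth_default _ (_ : size p <= k)%N) ?sz// /int_poly coef_Poly.
  by rewrite nth_default 1?size_map 1?size_tuple.
have := coef_int_poly c (Ordinal kn) => /= ->; rewrite tnth_mktuple/=.
have := pM (Ordinal kn); rewrite /= ltr_norml => /andP[p1 p2].
have p0 : 0 <= p`_k + M%:Z by rewrite -lerBlDr sub0r ltW.
rewrite inordK; first by rewrite gez0_abs// addrK.
by rewrite ltnS -lez_nat gez0_abs// -addnn PoszD lerD2r ltW.
Qed.

Lemma card_int_polys : (#|` fset_set (int_polys n h Q v)|)%fset%:R =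
  lattice_count Q M (coef_region h (Q `^ (- (2 * v))) : set (point n.+1)).
Proof.
pose S : pred cell :=
  fun c => `[< coef_region h (Q `^ (- (2 * v))) (grid_point Q c : point n.+1) >].
have int_polysP c : int_polys n h Q v (int_poly c) <-> S c.
  rewrite /S asboolE; exact: int_polys_region (map_int_poly c) (int_point_scale c).
(* [fset_set] is empty on infinite sets; writing the set as the image of a finite one ensures that
   its true cardinality is taken. *)
have -> : int_polys n h Q v = [set` [fset x in [seq int_poly c | c <- enum S]]%fset].
  apply/seteqP; split=> p /=; rewrite inE/=.
    move=> pP; have [c pE] := int_polys_ex pP; rewrite pE map_f// mem_enum.
    by apply/int_polysP; rewrite -pE.
  by move=> /mapP[c]; rewrite mem_enum => Sc ->; apply/int_polysP.
rewrite set_fsetK card_fseq undup_id; last by rewrite (map_inj_uniq int_poly_inj) enum_uniq.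
rewrite size_map -cardE -sum1_card natr_sum big_mkcond/=; apply: eq_bigr => c _.
rewrite indicE /S unfold_in.
by case: asboolP => cS; [rewrite mem_set|rewrite memNset].
Qed.

End Counting.

(** * Asymptotics *)

Section Asymptotics.
Context {R : realType}.
Implicit Types Q B : R.

(** The error is of order Q^(d-1); the extra factor [Q] on the left avoids this exponent at d =
    0. *)
Lemma lattice_err_le B (C d : nat) : 0 <= B -> exists2 c : R, 0 <= c &
  forall Q M, 1 <= Q -> M%:R <= Q * B + 1 -> lattice_err Q B M C d * Q <= c * Q ^+ d.
Proof.
move=> B0; elim: d => [|d [c c0 IH]].
  by exists 0 => // Q M _ _ /=; rewrite !mul0r.
pose k : R := (2 * C%:R + 1) * (2 * B) ^+ d.
have k0 : 0 <= k by rewrite mulr_ge0// ?exprn_ge0 ?addr_ge0 ?mulr_ge0.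
exists (k + (2 * B + 3) * c) => [|Q M Q1 MQ /=];
  first by rewrite addr_ge0// mulr_ge0// addr_ge0// mulr_ge0.
have Q0 : 0 <= Q by rewrite (le_trans _ Q1).
have Qd : 0 <= Q ^+ d by rewrite exprn_ge0.
have KQ : M.*2.+1%:R <= (2 * B + 3) * Q.
  by rewrite -addn1 natrD -muln2 natrM; nra.
have h := IH Q M Q1 MQ; rewrite -/k mulrDl -mulrA exprS.
have : M.*2.+1%:R * (lattice_err Q B M C d * Q) <= (2 * B + 3) * Q * (c * Q ^+ d).
  apply: (le_trans (ler_wpM2l _ h)) => //.
  by apply: ler_wpM2r => //; exact: mulr_ge0.
rewrite -[M.*2.+1%:R * _ * Q]mulrA => h'; apply: le_trans (lerD (lexx _) h') _.
by rewrite le_eqVlt; apply/orP; left; apply/eqP; ring.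
Qed.

(** A single constant [C] from [utame_coef_region] serves every discriminant bound, so [c] depends
    neither on [Q] nor on [v]. *)
Lemma card_int_polys_approx n (h : height_kind) : (0 < n)%N ->
  exists2 c : R, 0 <= c & forall Q v : R, 1 <= Q ->
    `|(#|` fset_set (int_polys n h Q v)|)%fset%:R -
      Q ^+ n.+1 * f0 n h (Q `^ (- (2 * v)))| <= c * Q ^+ n.
Proof.
move=> n0; pose B : R := 2 ^+ n; have B0 : 0 <= B by rewrite exprn_ge0.
have [C tC] := @utame_coef_region R n h.
have [c c0 cE] := lattice_err_le C n.+1 B0; exists c => // Q v Q1.
have Q0 : 0 < Q by exact: lt_le_trans Q1.
have QB0 : 0 <= Q * B by rewrite mulr_ge0// ltW.
have /andP[M1 M2] := truncn_itv QB0.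
pose M := (Num.truncn (Q * B)).+1.
have MQ : M%:R <= Q * B + 1 by rewrite /M -natr1 lerD2r.
rewrite (card_int_polys _ _ n0 Q0 (M2 : Q * 2 ^+ n < M%:R)).
have [l lE lM] := lattice_count_approx Q0 B0 (M2 : Q * B < M%:R) (tC (Q `^ (- (2 * v))))
  (fun t tS i => coef_region_bounded i tS).
rewrite /f0 lE/=; apply: le_trans lM _.
by rewrite -(ler_pM2r Q0) (le_trans (cE Q M Q1 MQ))// exprSr mulrA.
Qed.

Lemma near_pinfty_powR_lt (a b : R) : 0 < a -> 0 < b ->
  \forall Q \near +oo, Q `^ (- a) < b.
Proof.
move=> a0 b0; near=> Q.
have Q0 : 0 < Q by near: Q; exact: nbhs_pinfty_gt.
have Qb : b `^ (- a^-1) < Q by near: Q; exact: nbhs_pinfty_gt.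
have : (b `^ (- a^-1)) `^ a < Q `^ a.
  by apply: gt0_ltr_powR => //; rewrite nnegrE ?powR_ge0// ltW.
rewrite -powRrM mulNr mulVf ?gt_eqF// powR_inv1 ?ltW// powRN.
by rewrite -[X in _ -> _ < X]invrK ltf_pV2 ?posrE ?invr_gt0 ?powR_gt0.
Unshelve. all: by end_near.
Qed.

(** [N] stands for the count, [F] for the value of [f0] and [w] for (n + 2) v / n. The error c Q^n
    is negligible because w <= 1 - epsilon makes the main term at least of order Q^(n + epsilon). *)
Lemma ratio_sub1_lt n (lambda0 epsilon eta c Q w N F : R) :
  0 < lambda0 -> 0 < eta -> 0 <= c -> 1 <= Q -> w <= 1 - epsilon ->
  Q `^ (- epsilon) < eta / 2 * lambda0 / (c + 1) ->
  `|N - Q ^+ n.+1 * F| <= c * Q ^+ n ->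
  `|F / (lambda0 * Q `^ (- w)) - 1| < eta / 2 ->
  `|N / (lambda0 * Q `^ (n%:R + 1 - w)) - 1| < eta.
Proof.
move=> l0 eta0 c0 Q1 wE Qe err main.
have Q0 : 0 < Q by exact: lt_le_trans Q1.
have c1 : 0 < c + 1 by rewrite ltr_wpDl.
have QnE : Q `^ (n%:R + 1 - w) = Q ^+ n.+1 * Q `^ (- w).
  rewrite powRD; last by apply/implyP => _; rewrite gt_eqF.
  by rewrite -powR_mulrn ?ltW// -natr1.
rewrite QnE.
have Qw : 0 < Q `^ (- w) by rewrite powR_gt0.
have Qn : 0 < Q ^+ n by rewrite exprn_gt0.
(* Relative counting error plus relative error of the volume, each to be kept below eta / 2. *)
have -> : N / (lambda0 * (Q ^+ n.+1 * Q `^ (- w))) - 1 =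
    (N - Q ^+ n.+1 * F) / (lambda0 * (Q ^+ n.+1 * Q `^ (- w))) +
    (F / (lambda0 * Q `^ (- w)) - 1).
  by field; rewrite !gt_eqF// exprn_gt0.
rewrite (le_lt_trans (ler_normD _ _))// [ltRHS](splitr eta) ltrD//.
have D0 : 0 < lambda0 * (Q ^+ n.+1 * Q `^ (- w)) by rewrite !mulr_gt0// exprn_gt0.
rewrite normrM normfV (gtr0_norm D0) ltr_pdivrMr//.
apply: le_lt_trans err _.
(* The exponent 1 - w - epsilon is nonnegative and Q >= 1. *)
have QQw : 1 <= Q * Q `^ (- w) * Q `^ (- epsilon).
  rewrite -{1}(powRr1 (ltW Q0)) -!powRD; try by apply/implyP => _; rewrite gt_eqF.
  by rewrite -[leLHS](powRr0 Q); apply: ler_powR => //; lra.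
have Qep : 0 < Q `^ (- epsilon) by rewrite powR_gt0.
move: Qe; rewrite ltr_pdivlMr// => Qe.
have QQw0 : 0 < Q * Q `^ (- w) by rewrite mulr_gt0.
have {}Qe : c < eta / 2 * lambda0 * (Q * Q `^ (- w)).
  apply: (@lt_le_trans _ _ ((c + 1) * (Q * Q `^ (- w) * Q `^ (- epsilon)))).
    by apply: (@lt_le_trans _ _ (c + 1)); rewrite ?ltrDl// ler_peMr// ltW.
  rewrite mulrCA [leRHS]mulrC ler_pM2l// mulrC.
  exact: ltW.
rewrite exprS.
have -> : eta / 2 * (lambda0 * (Q * Q ^+ n * Q `^ (- w))) =
    eta / 2 * lambda0 * (Q * Q `^ (- w)) * Q ^+ n by ring.
by rewrite ltr_pM2r.
Qed.

End Asymptotics.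

Local Open Scope fset_scope.

(** The threshold for [Q] is chosen before [v], so the asymptotic equivalence is uniform in [v]. *)
Theorem corollary1 (R : realType) (n : nat) (h : height_kind)
    (epsilon lambda0 : R) :
  (4 <= n)%N ->
  0 < epsilon < 1 ->
  0 < lambda0 ->
  (f0 n h delta / (lambda0 * delta `^ ((n%:R + 2) / (2 * n%:R))))
    @[delta --> 0^'+] --> (1 : R) ->
  forall eta : R, 0 < eta ->
  \forall Q \near +oo,
  forall v : R, epsilon <= v <= (1 - epsilon) * (n%:R / (n%:R + 2)) ->
    `| #|` fset_set (int_polys n h Q v) |%:R /
       (lambda0 * Q `^ (n%:R + 1 - (n%:R + 2) / n%:R * v)) - 1 | < eta.
Proof.
move=> n4 /andP[e0 e1] l0 f01 eta eta0.
have n0 : (0 < n)%N by exact: leq_trans n4.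
have nR : 0 < n%:R :> R by rewrite ltr0n.
have eta2 : 0 < eta / 2 by rewrite divr_gt0.
have [r r0 rP] : exists2 r : R, 0 < r & forall delta, 0 < delta < r ->
    `|f0 n h delta / (lambda0 * delta `^ ((n%:R + 2) / (2 * n%:R))) - 1| < eta / 2.
  have /cvgrPdist_lt/(_ _ eta2) [r /= r0 rP] := f01.
  exists r => // delta /andP[d0 dr]; rewrite distrC; apply: rP => //=.
  by rewrite sub0r normrN gtr0_norm.
have [c c0 cE] := @card_int_polys_approx R n h n0.
have c1 : (0 < c + 1)%R by rewrite ltr_wpDl.
near=> Q => v /andP[ev ve].
have Q1 : 1 <= Q by near: Q; exact: nbhs_pinfty_ge.
have Q0 : 0 < Q by exact: lt_le_trans Q1.
(* Since v >= epsilon, every Q^(-2v) is at most Q^(-2 epsilon), so this condition free of [v] brings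
   all of them into the range of [rP]. *)
have Qr : Q `^ (- (2 * epsilon)) < r.
  by near: Q; apply: near_pinfty_powR_lt => //; rewrite mulr_gt0.
have Qe : Q `^ (- epsilon) < eta / 2 * lambda0 / (c + 1).
  by near: Q; apply: near_pinfty_powR_lt => //; rewrite !(divr_gt0, mulr_gt0).
pose w := (n%:R + 2) / n%:R * v.
have wE : w <= 1 - epsilon.
  have n2 : (0 < n%:R + 2 :> R)%R by rewrite addr_gt0.
  rewrite /w mulrC mulrA ler_pdivrMr// -ler_pdivlMr//.
  by move: ve; rewrite mulrA.
pose delta := Q `^ (- (2 * v)).
have d0 : 0 < delta by rewrite powR_gt0.
have dr : delta < r.
  by apply: le_lt_trans Qr; apply: ler_powR => //; rewrite lerN2 ler_pM2l.
have dE : delta `^ ((n%:R + 2) / (2 * n%:R)) = Q `^ (- w).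
  by rewrite /delta -powRrM; congr (_ `^ _); rewrite /w; field; rewrite gt_eqF.
rewrite -/w.
have := rP delta; rewrite d0 dr dE => /(_ isT) main.
exact: (ratio_sub1_lt l0 eta0 c0 Q1 wE Qe (cE Q v Q1) main).
Unshelve. all: by end_near.
Qed.
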